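(* Let $(\Omega,\mathcal F)$ be a measurable space such that $\mathcal F$ contains at least three pairwise disjoint non-null events, and let $\succeq$ be a preference order on $\mathcal L^\infty(\Omega,\mathcal F)$ satisfying (SM), (PC) and (ST). Then there exist a probability measure $\mathbb P$ on $(\Omega,\mathcal F)$ with $\mathcal N_\succeq=\{A\in\mathcal F:\mathbb P(A)=0\}$ and an $\mathcal F$-regular function $\mathbb u:\Omega\times\mathbb R\to\mathbb R$ with $\mathbb u(\cdot,x)\in\mathcal L^1(\Omega,\mathcal F,\mathbb P)$ for every $x\in\mathbb R$, such that for all $f,g\in\mathcal L^\infty(\Omega,\mathcal F)$, $$f\succeq g\iff \int_\Omega\mathbb u(\omega,f(\omega))\,\mathbb P(d\omega)\ge\int_\Omega\mathbb u(\omega,g(\omega))\,\mathbb P(d\omega).$$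
   Context: $\mathcal L^\infty(\Omega,\mathcal F)$: bounded $\mathcal F$-measurable real functions. Preference order: complete transitive relation; $\succ,\sim$ as usual. Null events $\mathcal N_\succeq=\{A\in\mathcal F: f1_A+g1_{A^c}\sim g\ \forall f,g\}$; non-null means not in $\mathcal N_\succeq$. (SM): for non-null $A$, every $f$ and constants $x>y$: $x1_A+f1_{A^c}\succ y1_A+f1_{A^c}$. (ST): if $f1_A+h1_{A^c}\succeq g1_A+h1_{A^c}$ then $f1_A+\tilde h1_{A^c}\succeq g1_A+\tilde h1_{A^c}$ for every $\tilde h$. (PC): for uniformly bounded $f_n\to f$ pointwise and $g\succ f$ (resp. $f\succ g$) there is $N$ with $g\succ f_n$ (resp. $f_n\succ g$) for $n>N$. A function $\varphi:\Omega\times\mathbb R\to\mathbb R$ is $\mathcal F$-regular if $\varphi(\omega,\cdot)$ is continuous and strictly increasing on $\mathbb R$ for every $\omega$, $\varphi(\omega,0)=0$ for every $\omega$, and $\varphi$ is $\mathcal F\otimes\mathcal B_{\mathbb R}$-measurable. *)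

(* Defs.v *)
From HB Require Import structures.
From mathcomp Require Import all_boot all_order all_algebra.
From mathcomp Require Import all_classical all_reals all_analysis.
Set Implicit Arguments. Unset Strict Implicit. Unset Printing Implicit Defensive.
Import Order.TTheory GRing.Theory Num.Theory.
Import numFieldNormedType.Exports.
Local Open Scope classical_set_scope.
Local Open Scope ring_scope.

Section Defs.
Context {d : measure_display} {T : measurableType d} {R : realType}.

Definition Linf (f : T -> R) : Prop :=
  measurable_fun setT f /\ exists M : R, forall w, `|f w| <= M.

Definition patch (A : set T) (f g : T -> R) : T -> R :=
  fun w => if w \in A then f w else g w.

Definition cstf (x : R) : T -> R := fun _ => x.

Definition preference_order (pref : (T -> R) -> (T -> R) -> Prop) : Prop :=
  (forall f g, Linf f -> Linf g -> pref f g \/ pref g f) /\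
  (forall f g h, Linf f -> Linf g -> Linf h -> pref f g -> pref g h -> pref f h).

Definition spref (pref : (T -> R) -> (T -> R) -> Prop) f g : Prop :=
  pref f g /\ ~ pref g f.
Definition ipref (pref : (T -> R) -> (T -> R) -> Prop) f g : Prop :=
  pref f g /\ pref g f.

Definition null_event (pref : (T -> R) -> (T -> R) -> Prop) (A : set T) : Prop :=
  measurable A /\
  forall f g, Linf f -> Linf g -> ipref pref (patch A f g) g.

Definition SM (pref : (T -> R) -> (T -> R) -> Prop) : Prop :=
  forall A, measurable A -> ~ null_event pref A ->
  forall f, Linf f -> forall x y : R, y < x ->
  spref pref (patch A (cstf x) f) (patch A (cstf y) f).

Definition ST (pref : (T -> R) -> (T -> R) -> Prop) : Prop :=
  forall A, measurable A ->
  forall f g h, Linf f -> Linf g -> Linf h ->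
  pref (patch A f h) (patch A g h) ->
  forall h', Linf h' -> pref (patch A f h') (patch A g h').

Definition PC (pref : (T -> R) -> (T -> R) -> Prop) : Prop :=
  forall (fs : nat -> T -> R) (f g : T -> R),
  (forall n, Linf (fs n)) -> Linf f -> Linf g ->
  (exists M : R, forall n w, `|fs n w| <= M) ->
  (forall w, (fun n => fs n w) @ \oo --> f w) ->
  (spref pref g f -> exists N, forall n, (N < n)%N -> spref pref g (fs n)) /\
  (spref pref f g -> exists N, forall n, (N < n)%N -> spref pref (fs n) g).

Definition F_regular (u : T -> R -> R) : Prop :=
  (forall w, continuous (u w)) /\
  (forall w (x y : R), x < y -> u w x < u w y) /\
  (forall w, u w 0 = 0) /\
  measurable_fun setT (fun p : T * R => u p.1 p.2).

End Defs.

(* Main.v *)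
Require Import Defs.
From HB Require Import structures.
From mathcomp Require Import all_boot all_order all_algebra.
From mathcomp Require Import all_classical all_reals all_analysis.
From mathcomp Require Import measurable_realfun ring lra zify.
Import Order.TTheory GRing.Theory Num.Theory.
Import numFieldNormedType.Exports.
Local Open Scope classical_set_scope.
Local Open Scope ring_scope.
Set Implicit Arguments. Unset Strict Implicit. Unset Printing Implicit Defensive.

(** Pointwise continuity gives every [f] a certainty equivalent [V f].  For an
  additive rescaling of [V], measure the gap between two values [v <= w] of
  functions vanishing on an event [G] by the largest number of consecutive
  utility steps worth [e], all taken on [G], that fit between them.  By the
  sure-thing principle this count does not depend on the functions
  realizing [v] and [w], nor on the event carrying the steps, and it is additive
  up to an error of 1; three disjoint non-null events provide the room for these
  comparisons.  Normalizing and letting [e] tend to 0 along an ultrafilter yields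
  a functional [I] which represents the preference, is additive on disjoint
  supports and is continuous along bounded pointwise limits.  Then
  [A |-> I (1_A)] is, up to a factor, the probability, the charges
  [A |-> I (x 1_A)] have densities [g x], and the utility extends [g]
  from the dyadic numbers; it has no jumps because the location of the first jump
  would be a measurable function at which [I] is discontinuous. *)

(** * Bounded measurable functions *)

Section BoundedMeasurable.
Context {d : measure_display} {T : measurableType d} {R : realType}.
Implicit Types (f g h : T -> R) (A D E : set T).

(** The values of [V] are only ordinal, so sizes must be produced by comparisons alone. Non-null
    events may be atoms, hence equal steps cannot come from cutting events; they come from varying
    the functions, continuity along segments supplying the intermediate values. A step taken on [G]
    leaves the class of functions vanishing on [G]; the next one is possible only because the value
    reached lies in an interval of values and is attained again by a function vanishing on [G].
    Counts fail to be additive only through a step straddling an intermediate value, and this single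
    step is negligible against the count of a fixed unit, which tends to infinity. With an
    ultrafilter, boundedness of the normalized counts is enough, and one choice of limit serves all
    values at once. For the utility the obstacle is that each density is determined only almost
    everywhere, with an exceptional set depending on [x]. Monotonicity and continuity are therefore
    stated on the countable dyadic grid, where one null set can be repaired. *)

Lemma LinfM f : Linf f -> exists2 M : R, 0 <= M & forall w, `|f w| <= M.
Proof.
move=> [_ [M fM]]; exists (Num.max M 0); first by rewrite le_max lexx orbT.
by move=> w; rewrite le_max fM.
Qed.

Lemma Linf_cst (x : R) : Linf (cstf x : T -> R).
Proof. by split; [exact: measurable_cst | exists `|x|]. Qed.

Lemma LinfD f g : Linf f -> Linf g -> Linf (f + g).
Proof.
move=> [mf [M fM]] [mg [N gN]]; split; first exact: measurable_funD.
by exists (M + N) => w; rewrite (le_trans (ler_normD _ _)) // lerD.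
Qed.

Lemma LinfZ (c : R) f : Linf f -> Linf (c \*o f).
Proof.
move=> [mf [M fM]]; split; first exact: measurable_funM.
by exists (`|c| * M) => w /=; rewrite normrM ler_wpM2l.
Qed.

Lemma measurable_mem A : measurable A -> measurable_fun setT (fun w : T => w \in A).
Proof.
move=> mA; apply: (@measurable_fun_bool _ _ _ _ true); rewrite setTI.
by rewrite (_ : _ @^-1` _ = A)//; apply/seteqP; split => w /=; [move/set_mem|move/mem_set].
Qed.

Lemma Linf_patch A f g : measurable A -> Linf f -> Linf g ->
  Linf (Defs.patch A f g).
Proof.
move=> mA [mf [M fM]] [mg [N gN]]; split.
  by apply: measurable_fun_ifT => //; exact: measurable_mem.
by exists (Num.max M N) => w; rewrite /Defs.patch; case: ifP => _;
  rewrite le_max ?fM ?gN ?orbT.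
Qed.

Lemma addfE f g w : (f + g) w = f w + g w.
Proof. by []. Qed.

Definition supp D f := forall w, ~ D w -> f w = 0.

Definition restr D f : T -> R := Defs.patch D f (cstf 0).

Lemma restr_in D f w : D w -> restr D f w = f w.
Proof. by move=> Dw; rewrite /restr /Defs.patch mem_set. Qed.

Lemma restr_notin D f w : ~ D w -> restr D f w = 0.
Proof. by move=> Dw; rewrite /restr /Defs.patch memNset. Qed.

Lemma supp_restr D f : supp D (restr D f).
Proof. by move=> w /restr_notin ->. Qed.

Lemma Linf_restr D f : measurable D -> Linf f -> Linf (restr D f).
Proof. by move=> mD Lf; apply: Linf_patch => //; exact: Linf_cst. Qed.

Lemma suppD D f g : supp D f -> supp D g -> supp D (f + g).
Proof. by move=> sf sg w Dw; rewrite addfE sf// sg// addr0. Qed.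

Lemma suppS D E f : D `<=` E -> supp D f -> supp E f.
Proof. by move=> DE sf w Ew; apply: sf => /DE. Qed.

Lemma supp0 D : supp D 0.
Proof. by []. Qed.

Lemma restr_id D f : supp D f -> restr D f = f.
Proof.
move=> sf; apply/funext => w; have [Dw|Dw] := pselect (D w).
  by rewrite restr_in.
by rewrite restr_notin// sf.
Qed.

Lemma restr0 D : restr D 0 = 0.
Proof. exact/restr_id. Qed.

Lemma restr_disjoint D E f : D `&` E = set0 -> supp E f -> restr D f = 0.
Proof.
move=> DE sf; apply/funext => w; have [Dw|Dw] := pselect (D w).
  by rewrite restr_in// sf// => Ew; rewrite -[False]/(set0 w) -DE.
by rewrite restr_notin.
Qed.

Lemma restrD D f g : restr D (f + g) = restr D f + restr D g.
Proof.
apply/funext => w; rewrite addfE.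
by have [Dw|Dw] := pselect (D w);
  rewrite ?(restr_in _ Dw) ?(restr_notin _ Dw) ?addr0.
Qed.

Lemma restrE D (x : R) w : restr D (cstf x) w = x * (w \in D)%:R.
Proof.
by rewrite /restr /Defs.patch; case: (_ \in _); rewrite ?mulr1 ?mulr0.
Qed.

Lemma patchE D f g : Defs.patch D f g = restr D f + restr (~` D) g.
Proof.
apply/funext => w; rewrite addfE.
have [Dw|Dw] := pselect (D w).
  by rewrite /Defs.patch mem_set// restr_in// restr_notin ?addr0.
by rewrite /Defs.patch memNset// restr_notin// restr_in// add0r.
Qed.

Lemma patch_supp D f g : supp D f -> supp (~` D) g -> Defs.patch D f g = f + g.
Proof. by move=> sf sg; rewrite patchE !restr_id. Qed.

(** * Dyadic floors *)

Definition dy n (k : int) : R := k%:~R / 2 ^+ n.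
(** Monotone in [x], so it preserves measurability, and within [2 ^- n] of [x], so it gives bounded
    simple approximations. The utility is later built on the same grid. *)
Definition fl n (x : R) := dy n (Num.floor (x * 2 ^+ n)).

Lemma exp2_gt0 n : 0 < 2 ^+ n :> R.
Proof. by rewrite exprn_gt0. Qed.

Lemma fl_le n x : fl n x <= x.
Proof. by rewrite /fl /dy ler_pdivrMr ?exp2_gt0// floor_le. Qed.

Lemma fl_gt n x : x < fl n x + 2 ^- n.
Proof.
rewrite /fl /dy -[X in _ + X]mul1r -mulrDl ltr_pdivlMr ?exp2_gt0//.
by have /andP[_] := floor_itv (x * 2 ^+ n); rewrite intrD.
Qed.

Lemma fl_homo n : {homo fl n : x y / x <= y}.
Proof.
move=> x y xy; rewrite /fl /dy ler_pM2r ?invr_gt0 ?exp2_gt0// ler_int.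
by rewrite le_floor// ler_pM2r ?exp2_gt0.
Qed.

Lemma fl_norm n x : `|fl n x| <= `|x| + 1.
Proof.
have := fl_le n x; have := fl_gt n x.
have : 2 ^- n <= 1 :> R by rewrite invf_le1 ?exp2_gt0// exprn_ege1// ler1n.
move: (ler_norm x) (ler_norm (- x)); rewrite normrN ler_norml; lra.
Qed.

Lemma cvg_exp2V : (2 ^- n : R) @[n --> \oo] --> (0 : R).
Proof.
rewrite (_ : (fun n => _) = GRing.exp (2^-1 : R)); last first.
  by apply/funext => n; rewrite exprVn.
by apply: cvg_expr; rewrite ger0_norm ?invr_ge0// invf_lt1// ltr1n.
Qed.

Lemma fl_cvg x : fl n x @[n --> \oo] --> x.
Proof.
apply: (@squeeze_cvgr _ _ _ _ (fun n => x - 2 ^- n) (cst x)).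
- near=> n; rewrite fl_le andbT lerBlDr ltW// fl_gt//.
- rewrite -[X in _ --> X]subr0; apply: cvgB; first exact: cvg_cst.
  exact: cvg_exp2V.
- exact: cvg_cst.
Unshelve. all: by end_near. Qed.

Lemma Linf_fl n f : Linf f -> Linf (fl n \o f).
Proof.
move=> [mf [M fM]]; split; last first.
  by exists (M + 1) => w /=; rewrite (le_trans (fl_norm _ _))// lerD2r.
by apply: measurableT_comp => //; apply: nondecreasing_measurable => //;
  exact: fl_homo.
Qed.

Lemma fl_finite n f : Linf f -> exists s : seq int, 
  forall w, Num.floor (f w * 2 ^+ n) \in s.
Proof.
move=> /LinfM[M M0 fM].
pose K := `|Num.floor (M * 2 ^+ n)|.+1.
exists [seq (k%:Z - K%:Z)%R | k <- iota 0 (K + K).+1] => w.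
set z := Num.floor _.
have z1 : (z <= K%:Z).
  rewrite /K; apply: (@le_trans _ _ (Num.floor (M * 2 ^+ n))); last by lia.
  by rewrite le_floor// ler_pM2r ?exp2_gt0// (le_trans (ler_norm _)).
have z2 : (- K%:Z <= z).
  rewrite floor_ge_int rmorphN /= lerNl -mulNr.
  apply: (@le_trans _ _ (M * 2 ^+ n)).
    by rewrite ler_pM2r ?exp2_gt0// (le_trans (ler_norm _))// normrN.
  have /andP[_ /ltW] := floor_itv (M * 2 ^+ n).
  move=> /le_trans; apply; rewrite ler_int /K.
  by move: (Num.floor (M * _)) => q; lia.
apply/mapP; exists (absz (z + K%:Z)); last by lia.
by rewrite mem_iota; lia.
Qed.

End BoundedMeasurable.

(** * Certainty equivalents *)

Section CertaintyEquivalent.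
Context {d : measure_display} {T : measurableType d} {R : realType}.
Variable pref : (T -> R) -> (T -> R) -> Prop.
Hypotheses (po : preference_order pref) (sm : SM pref) (pc : PC pref)
  (st : ST pref).
Variable A0 : set T.
Hypotheses (mA0 : measurable A0) (nnA0 : ~ null_event pref A0).
Implicit Types (f g h : T -> R).

Lemma null_event_subset (A B : set T) : measurable A -> A `<=` B ->
  null_event pref B -> null_event pref A.
Proof.
move=> mA AB [mB nB]; split=> // f g Lf Lg.
have := nB _ _ (Linf_patch mA Lf Lg) Lg; congr (ipref pref _ _).
apply/funext => w; rewrite {1}/Defs.patch; case: ifPn => // /negP Bw.
rewrite /Defs.patch memNset// => Aw; apply: Bw; exact/mem_set/AB.
Qed.

Lemma pref_refl f : Linf f -> pref f f.
Proof. by move=> Lf; case: (po.1 _ _ Lf Lf). Qed.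

Lemma pref_trans g f h : Linf f -> Linf g -> Linf h ->
  pref f g -> pref g h -> pref f h.
Proof. exact: po.2. Qed.

Lemma not_pref f g : Linf f -> Linf g -> ~ pref f g -> spref pref g f.
Proof. by move=> Lf Lg fg; split=> //; case: (po.1 _ _ Lf Lg). Qed.

Lemma setT_nonnull : ~ null_event pref setT.
Proof. by apply: contra_not nnA0; exact: null_event_subset. Qed.

Lemma pref_patch_cst A (x y : R) f : measurable A -> Linf f -> x <= y ->
  pref (Defs.patch A (cstf y) f) (Defs.patch A (cstf x) f).
Proof.
move=> mA Lf; rewrite le_eqVlt => /orP[/eqP <-|xy].
  by apply/pref_refl/Linf_patch => //; exact: Linf_cst.
have [nA|nA] := pselect (null_event pref A); last first.
  by have [] := sm mA nA Lf xy.
have [L1 L2] := (Linf_patch mA (Linf_cst y) Lf, Linf_patch mA (Linf_cst x) Lf).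
have [h1 _] := nA.2 _ _ (Linf_cst y) Lf.
have [_ h2] := nA.2 _ _ (Linf_cst x) Lf.
exact: pref_trans h1 h2.
Qed.

(** [h l] follows [g] where the pair of values of [f] and [g] is listed in [l], and [f] elsewhere.
    Adding a pair raises one constant on one level set, a case of [pref_patch_cst]. *)
Lemma pref_mono_fin (l : seq (R * R)) f g : Linf f -> Linf g ->
  (forall w, f w <= g w) -> (forall w, (f w, g w) \in l) -> pref g f.
Proof.
move=> Lf Lg fg fgl.
pose h (l : seq (R * R)) w := if (f w, g w) \in l then g w else f w.
suff [] : Linf (h l) /\ pref (h l) f.
  by rewrite (_ : h l = g)//; apply/funext => w; rewrite /h fgl.
elim: {fgl}l => [|[x y] l [Lh hf]].
  by rewrite (_ : h [::] = f)//; split=> //; exact: pref_refl.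
pose A := (f @^-1` [set x]) `&` (g @^-1` [set y]).
have mA : measurable A.
  by apply: measurableI; rewrite -[X in measurable X]setTI;
    [apply: Lf.1|apply: Lg.1].
have hE : h ((x, y) :: l) = Defs.patch A (cstf y) (h l).
  apply/funext => w; rewrite /h /Defs.patch inE.
  have [[fx gy]|nA] := pselect (A w).
    by rewrite mem_set//= fx gy eqxx /cstf.
  rewrite (memNset nA); case: eqVneq => //= -[fx gy].
  by exfalso; apply: nA.
split; first by rewrite hE; apply: Linf_patch => //; exact: Linf_cst.
have [xy|xy] := leP x y; last first.
  rewrite hE (_ : Defs.patch _ _ _ = h l)//; apply/funext => w.
  rewrite /Defs.patch memNset// => -[fx gy].
  by have := fg w; rewrite fx gy leNgt xy.
(* The pair may already occur in [l], so the value of [h l] on [A] is [y] or [x]. *)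
pose z := if (x, y) \in l then y else x.
have hz : h l = Defs.patch A (cstf z) (h l).
  apply/funext => w; rewrite /Defs.patch; case: ifPn => // /set_mem[fx gy].
  by rewrite /h fx gy.
rewrite hE; apply: (pref_trans _ _ _ _ hf) => //.
  by apply: Linf_patch => //; exact: Linf_cst.
by rewrite [X in pref _ X]hz; apply: pref_patch_cst => //; rewrite /z; case: ifP.
Qed.

(** [PC] preserves strict preferences only, hence the contradiction: a strict preference for [f]
    would survive replacing [f] by a simple function below it and [g] by one above it, against the
    finite case. *)
Lemma pref_mono f g : Linf f -> Linf g -> (forall w, f w <= g w) -> pref g f.
Proof.
move=> Lf Lg fg; apply: contrapT => /(not_pref Lg Lf) sfg.
have [M _ fM] := LinfM Lf; have [N _ gN] := LinfM Lg.
have [] := @pc (fun n => fl n \o f) f g (fun n => Linf_fl n Lf) Lf Lg.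
- by exists (M + 1) => n w; rewrite (le_trans (fl_norm _ _))// lerD2r.
- by move=> w; exact: fl_cvg.
move=> _ /(_ sfg)[n0 h0].
have {h0} := h0 n0.+1 (ltnSn _); set n := n0.+1 => h0.
pose gs m : T -> R := (fl m \o g) + cstf (2 ^- m).
have Lgs m : Linf (gs m) by apply: LinfD; [exact: Linf_fl|exact: Linf_cst].
have [] := @pc gs g (fl n \o f) Lgs Lg (Linf_fl n Lf).
- exists (N + 1 + 1) => m w; rewrite /gs addfE (le_trans (ler_normD _ _))// lerD//.
    by rewrite (le_trans (fl_norm _ _))// lerD2r.
  by rewrite /cstf ger0_norm ?invr_ge0 ?exprn_ge0// invf_le1 ?exp2_gt0// exprn_ege1// ler1n.
- move=> w; rewrite -[X in _ --> X]addr0; apply: cvgD; first exact: fl_cvg.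
  exact: cvg_exp2V.
move=> /(_ h0)[m0 /(_ m0.+1 (ltnSn _))[_ +]] _; apply.
have [s1 hs1] := fl_finite n Lf; have [s2 hs2] := fl_finite m0.+1 Lg.
apply: (@pref_mono_fin [seq (dy n a, dy m0.+1 b + 2 ^- m0.+1) | a <- s1, b <- s2]) => //.
- exact: Linf_fl.
- move=> w; rewrite /gs addfE /= (le_trans (fl_le _ _))// (le_trans (fg w))//.
  by rewrite ltW// fl_gt.
- by move=> w; apply: (allpairs_f (fun a b => (dy n a, dy m0.+1 b + 2 ^- m0.+1))).
Qed.

Definition ceq f : R := sup [set x | pref f (cstf x)].

Lemma spref_cst (x y : R) : y < x -> spref pref (cstf x) (cstf y).
Proof.
move=> yx; have := sm measurableT setT_nonnull (Linf_cst 0) yx.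
by congr (spref pref _ _); apply/funext => w; rewrite /Defs.patch in_setT.
Qed.

Lemma pref_cst (x y : R) : pref (cstf x) (cstf y) <-> y <= x.
Proof.
split=> [xy|yx]; last by apply: pref_mono => //; exact: Linf_cst.
by rewrite leNgt; apply/negP => /spref_cst[].
Qed.

Lemma ceq_has_sup f : Linf f -> has_sup [set x | pref f (cstf x)].
Proof.
move=> Lf; have [M M0 fM] := LinfM Lf; split.
  exists (- M); apply: pref_mono => //; first exact: Linf_cst.
  by move=> w; rewrite /cstf; have := fM w; rewrite ler_norml => /andP[].
exists M => x /= fx; apply/pref_cst.
apply: (pref_trans _ Lf _ _ fx); try exact: Linf_cst.
apply: pref_mono => //; first exact: Linf_cst.
by move=> w; rewrite /cstf; have := fM w; rewrite ler_norml => /andP[].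
Qed.

Lemma cvg_cstf (c : R) (s : R) w :
  (fun n => (cstf (c + s * 2 ^- n) : T -> R) w) @ \oo --> cstf c w.
Proof.
rewrite /cstf -[X in _ --> X]addr0 -[in X in _ --> X](mulr0 s).
by apply: cvgD; [exact: cvg_cst|apply: cvgM; [exact: cvg_cst|exact: cvg_exp2V]].
Qed.

Lemma cstf_bounded (c s : R) : exists M : R,
  forall n w, `|(cstf (c + s * 2 ^- n) : T -> R) w| <= M.
Proof.
exists (`|c| + `|s|) => n w; rewrite /cstf (le_trans (ler_normD _ _))// lerD2l.
rewrite normrM ler_piMr// ger0_norm ?invr_ge0 ?exprn_ge0//.
by rewrite invf_le1 ?exp2_gt0// exprn_ege1// ler1n.
Qed.

(** A strict preference between [f] and the constant [ceq f] would, by [PC], survive a shift of the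
    constant by [2 ^- n], against the definition of [ceq f] as a supremum. *)
Lemma ceqP f : Linf f -> ipref pref f (cstf (ceq f)).
Proof.
move=> Lf; have hs := ceq_has_sup Lf.
have Lc x : Linf (cstf x : T -> R) by exact: Linf_cst.
have PCc s := pc (fun n => Lc (ceq f + s * 2 ^- n)) (Lc (ceq f)) Lf
  (cstf_bounded _ _) (@cvg_cstf (ceq f) s).
split; apply: contrapT => /not_pref - /(_ _ _)[]//.
- move=> h1 h2; have [_ /(_ (conj h1 h2))[N /(_ N.+1 (ltnSn _))[h3 h4]]] := PCc (-1).
  have e0 : 0 < 2 ^- N.+1 :> R by rewrite invr_gt0 exp2_gt0.
  have [x /= fx xc] := sup_adherent e0 hs; apply: h4.
  apply: (pref_trans Lf (Lc x)) => //; apply/pref_cst.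
  by rewrite mulN1r ltW.
- move=> h1 h2; have [/(_ (conj h1 h2))[N /(_ N.+1 (ltnSn _))[h3 h4]] _] := PCc 1.
  have := ub_le_sup hs.2 h3; rewrite -/(ceq f) mul1r.
  by rewrite gerDl leNgt invr_gt0 exp2_gt0.
Qed.

Lemma pref_ceq f g : Linf f -> Linf g -> pref f g <-> ceq g <= ceq f.
Proof.
move=> Lf Lg; have [f1 f2] := ceqP Lf; have [g1 g2] := ceqP Lg.
have Lc x : Linf (cstf x : T -> R) by exact: Linf_cst.
split=> [fg|/pref_cst fg].
  apply/pref_cst; apply: (pref_trans _ Lf _ f2) => //.
  exact: (pref_trans _ Lg).
apply: (pref_trans _ (Lc (ceq f))) => //.
exact: (pref_trans _ (Lc (ceq g))).
Qed.

Lemma spref_ceq f g : Linf f -> Linf g -> spref pref f g <-> ceq g < ceq f.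
Proof.
move=> Lf Lg; rewrite /spref !pref_ceq// ltNge; split=> [[_ /negP]//|/negP h].
by split=> //; rewrite leNgt; apply/negP => /ltW.
Qed.

Lemma ceq_cst x : ceq (cstf x) = x.
Proof.
have [h1 h2] := ceqP (Linf_cst x).
by apply/eqP; rewrite eq_le; apply/andP; split; apply/pref_cst.
Qed.

Lemma ceq_mono f g : Linf f -> Linf g -> (forall w, f w <= g w) ->
  ceq f <= ceq g.
Proof. by move=> Lf Lg fg; apply/pref_ceq => //; exact: pref_mono. Qed.

(** Constants are their own certainty equivalents, so [PC] against the constants [ceq f + e] and
    [ceq f - e] traps [ceq (fs n)]. *)
Lemma ceq_cvg (fs : nat -> T -> R) f (M : R) : (forall n, Linf (fs n)) ->
  Linf f -> (forall n w, `|fs n w| <= M) ->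
  (forall w, (fun n => fs n w) @ \oo --> f w) ->
  (fun n => ceq (fs n)) @ \oo --> ceq f.
Proof.
move=> Lfs Lf fsM fsf; apply/cvgrPdist_le => e e0.
have Lc x : Linf (cstf x : T -> R) by exact: Linf_cst.
have PCc x := pc Lfs Lf (Lc x) (ex_intro _ M fsM) fsf.
have [/(_ _)[]] := PCc (ceq f + e).
  by apply/spref_ceq => //; rewrite ceq_cst ltrDl.
move=> N1 h1 _.
have [_ /(_ _)[]] := PCc (ceq f - e).
  by apply/spref_ceq => //; rewrite ceq_cst ltrBlDr ltrDl.
move=> N2 h2; exists (maxn N1 N2).+1 => // n /=; rewrite gtn_max => /andP[n1 n2].
have /spref_ceq := h1 _ n1; rewrite ceq_cst => /(_ (Lc _) (Lfs _)) l1.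
have /spref_ceq := h2 _ n2; rewrite ceq_cst => /(_ (Lfs _) (Lc _)) l2.
by rewrite ler_norml; apply/andP; split; lra.
Qed.

Lemma ceq_ST D f g h h' : measurable D ->
  Linf f -> Linf g -> Linf h -> Linf h' ->
  supp D f -> supp D g -> supp (~` D) h -> supp (~` D) h' ->
  ceq (f + h) <= ceq (g + h) -> ceq (f + h') <= ceq (g + h').
Proof.
move=> mD Lf Lg Lh Lh' sf sg sh sh' fg.
apply/pref_ceq; [exact: LinfD|exact: LinfD|].
rewrite -!(@patch_supp _ _ _ D)//; apply: (st mD Lg Lf Lh) => //.
by rewrite !patch_supp//; apply/pref_ceq => //; exact: LinfD.
Qed.

Lemma ceq_SM D (x y : R) f : measurable D -> ~ null_event pref D -> Linf f ->
  y < x -> ceq (Defs.patch D (cstf y) f) < ceq (Defs.patch D (cstf x) f).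
Proof.
move=> mD nD Lf yx; apply/spref_ceq; last exact: sm;
  by apply: Linf_patch => //; exact: Linf_cst.
Qed.

End CertaintyEquivalent.

(** * Additive rescaling of the certainty equivalent *)

Section Chains.
Context {d : measure_display} {T : measurableType d} {R : realType}.
Variable V : (T -> R) -> R.
Hypotheses (V0 : V 0 = 0)
  (Vmono : forall f g, Linf f -> Linf g -> (forall w, f w <= g w) -> V f <= V g)
  (Vcvg : forall (fs : nat -> T -> R) f (M : R), (forall n, Linf (fs n)) ->
    Linf f -> (forall n w, `|fs n w| <= M) ->
    (forall w, (fun n => fs n w) @ \oo --> f w) ->
    (fun n => V (fs n)) @ \oo --> V f)
  (VST : forall D f g h h', measurable D ->
    Linf f -> Linf g -> Linf h -> Linf h' ->
    supp D f -> supp D g -> supp (~` D) h -> supp (~` D) h' ->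
    V (f + h) <= V (g + h) -> V (f + h') <= V (g + h')).
Implicit Types (f g h k : T -> R) (D E G : set T) (u v w e : R).

Definition on D f := Linf f /\ supp D f.

Lemma on0 D : on D 0.
Proof. by split; [exact: Linf_cst|exact: supp0]. Qed.

Lemma onS D E f : D `<=` E -> on D f -> on E f.
Proof. by move=> DE [Lf sf]; split=> //; exact: suppS sf. Qed.

Lemma onD D f g : on D f -> on D g -> on D (f + g).
Proof. by move=> [Lf sf] [Lg sg]; split; [exact: LinfD|exact: suppD]. Qed.

Lemma onU D E f g : on D f -> on E g -> on (D `|` E) (f + g).
Proof.
move=> Df Eg; apply: onD; [apply: onS Df|apply: onS Eg].
  exact: subsetUl.
exact: subsetUr.
Qed.

Lemma onZ D (c : R) f : on D f -> on D (c \*o f).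
Proof.
by move=> [Lf sf]; split; [exact: LinfZ|move=> w /sf /= ->; rewrite mulr0].
Qed.

Lemma on_restr D f : measurable D -> Linf f -> on D (restr D f).
Proof. by move=> mD Lf; split; [exact: Linf_restr|exact: supp_restr]. Qed.

Lemma V_indep D E f g h h' : measurable D -> D `&` E = set0 ->
  on D f -> on D g -> on E h -> on E h' ->
  V (f + h) <= V (g + h) -> V (f + h') <= V (g + h').
Proof.
move=> mD DE [Lf sf] [Lg sg] [Lh sh] [Lh' sh'].
have ED : E `<=` ~` D by apply/disjoints_subset; rewrite setIC.
by apply: (VST mD) => //; apply: suppS ED _.
Qed.

(** The cancellation law through which the sure-thing principle acts from here on. *)
Lemma V_add_le D E f g h : measurable D -> D `&` E = set0 ->
  on D f -> on D g -> on E h -> (V (f + h) <= V (g + h)) = (V f <= V g).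
Proof.
move=> mD DE Df Dg Eh; apply/idP/idP => fg.
  by have := V_indep mD DE Df Dg Eh (on0 E) fg; rewrite !addr0.
by apply: (V_indep mD DE Df Dg (on0 E) Eh); rewrite !addr0.
Qed.

Lemma V_add_eq D E f g h : measurable D -> D `&` E = set0 ->
  on D f -> on D g -> on E h -> V f = V g -> V (f + h) = V (g + h).
Proof.
move=> mD DE Df Dg Eh fg; apply/eqP; rewrite eq_le.
by rewrite !(V_add_le mD DE)// fg lexx.
Qed.

Lemma V_add_gt D E f h : measurable D -> D `&` E = set0 ->
  on D f -> on E h -> 0 < V f -> V h < V (f + h).
Proof.
move=> mD DE Df Eh f0; rewrite -[X in V X < _]add0r ltNge.
by rewrite (V_add_le mD DE)//; [rewrite V0 -ltNge|exact: on0].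
Qed.

(** The source of all intermediate values below. Sequences suffice on the real line, and a
    convergent one is bounded, as [Vcvg] requires. *)
Lemma V_path f g : Linf f -> Linf g -> continuous (fun t : R => V (f + t \*o g)).
Proof.
move=> Lf Lg p; apply/(@cvg_nbhsP _ R^o) => u up.
have [M [_ uM]] := cvg_seq_bounded (cvgP _ up).
have {}uM n : `|u n| <= `|M| + 1.
  by apply: uM => //; rewrite ltr_pwDr// ler_norm.
have [Mf Mf0 hf] := LinfM Lf; have [Mg Mg0 hg] := LinfM Lg.
apply: (@Vcvg (fun n => f + u n \*o g) _ (Mf + (`|M| + 1) * Mg)).
- by move=> n; apply: LinfD => //; exact: LinfZ.
- by apply: LinfD => //; exact: LinfZ.
- move=> n w; rewrite addfE (le_trans (ler_normD _ _))// lerD//= normrM.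
  by rewrite ler_pM.
- move=> w; rewrite /= addfE; apply: cvgD; first exact: cvg_cst.
  by apply: cvgM => //; exact: cvg_cst.
Qed.

Lemma V_IVT f g (a b : R) v : Linf f -> Linf g -> a <= b ->
  V (f + a \*o g) <= v <= V (f + b \*o g) ->
  exists2 c, a <= c <= b & V (f + c \*o g) = v.
Proof.
move=> Lf Lg ab /andP[va vb].
have [|||c] := @IVT R (fun t => V (f + t \*o g)) a b v => //.
- exact/continuous_subspaceT/V_path.
- by rewrite ge_min le_max va vb orbT.
by rewrite in_itv /= => cab cv; exists c.
Qed.

(** By [inJ_convex] these values form an interval, containing 0: a value is located by inequalities,
    and a function realizing it follows. *)
Definition inJ D v := exists2 f, on D f & V f = v.

Lemma inJS D E v : D `<=` E -> inJ D v -> inJ E v.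
Proof. by move=> DE [f Df <-]; exists f => //; exact: onS Df. Qed.

Lemma inJ0 D : inJ D 0.
Proof. by exists 0 => //; exact: on0. Qed.

Lemma V_between D f g h v : on D f -> on D g -> Linf h ->
  V (f + h) <= v <= V (g + h) -> exists2 k, on D k & V (k + h) = v.
Proof.
move=> Df Dg Lh fvg.
pose l := g + (-1) \*o f.
have Dl : on D l by apply: onD => //; exact: onZ.
have e0 : f + h + 0 \*o l = f + h.
  by apply/funext => x; rewrite addfE /= mul0r addr0.
have e1 : f + h + 1 \*o l = g + h.
  by apply/funext => x; rewrite /l !addfE /= addfE /=; ring.
have [||||c _ <-] := @V_IVT (f + h) l 0 1 v.
- by apply: LinfD => //; exact: Df.1.
- exact: Dl.1.
- exact: ler01.
- by rewrite e0 e1.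
exists (f + c \*o l); last by rewrite addrAC.
by apply: onD => //; exact: onZ.
Qed.

Lemma inJ_convex D u v w : inJ D u -> inJ D w -> u <= v <= w -> inJ D v.
Proof.
move=> [f Df <-] [g Dg <-] fvg.
have [|k Dk <-] := @V_between D f g 0 v Df Dg (on0 D).1; first by rewrite !addr0.
by exists k => //; rewrite addr0.
Qed.

Definition gauge G e := [/\ measurable G, 0 < e & inJ G e].

(* [chain G e n v w]: there is room for [n] steps of size [e] on [G] between
   the values [v] and [w] of functions vanishing on [G]. *)
Fixpoint chain G e n v w : Prop :=
  if n is m.+1 then exists f k,
    [/\ on (~` G) f, on G k, V f = v, V k = e & chain G e m (V (f + k)) w]
  else v <= w.

(** * Counting steps on one event *)

Section gauge.
Variables (G : set T) (e : R).
Hypothesis Hg : gauge G e.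

Let mG : measurable G. Proof. by case: Hg. Qed.
Let e0 : 0 < e. Proof. by case: Hg. Qed.
Let Ge : inJ G e. Proof. by case: Hg. Qed.

Let CG : ~` G `&` G = set0.
Proof. by rewrite setIC setICr. Qed.

Lemma chain_le n v w : chain G e n v w -> v <= w.
Proof.
elim: n v => [//|n IH] v /= [f [k [Gf Gk <- ke /IH]]]; apply: le_trans.
by rewrite addrC ltW// (@V_add_gt G (~` G))// ?ke// setICr.
Qed.

(** The existential choice in [chain] is immaterial: two uses of [V_add_eq] show that [V (f + k)]
    depends only on [V f] and [V k]. *)
Lemma chainS n f k w : on (~` G) f -> on G k -> V k = e ->
  chain G e n.+1 (V f) w <-> chain G e n (V (f + k)) w.
Proof.
move=> Gf Gk ke; split; last by exists f, k.
move=> [f' [k' [Gf' Gk' ff' ke' c]]].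
suff -> : V (f + k) = V (f' + k') by [].
have mCG := measurableC mG.
rewrite (V_add_eq mCG CG Gf Gf' Gk (esym ff')).
by rewrite ![f' + _]addrC; apply: (@V_add_eq G (~` G)); rewrite ?setICr// ke.
Qed.

(** The value reached by the first step is that of [f + k], which need not vanish on [G]. It lies
    between [v] and [w], hence is also the value of a function that does, and the next step can
    again be taken on [G]. *)
Lemma chain_inJ n v w : inJ (~` G) v -> inJ (~` G) w -> 
  chain G e n.+1 v w -> exists2 u, inJ (~` G) u &
    v < u /\ (forall m w', chain G e m.+1 v w' <-> chain G e m u w').
Proof.
move=> [f Gf <-] Jw; have [k Gk ke] := Ge => /(chainS _ _ Gf Gk ke) c.
have lt : V f < V (f + k) by rewrite addrC (@V_add_gt G (~` G))// ?setICr// ke.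
exists (V (f + k)).
  apply: (@inJ_convex _ (V f) _ w) => //; first by exists f.
  by rewrite (ltW lt)/=; exact: chain_le c.
by split=> // m w'; exact: chainS.
Qed.

Lemma chain_wl n u v w : inJ (~` G) u -> inJ (~` G) w -> u <= v ->
  chain G e n v w -> chain G e n u w.
Proof.
move=> + Jw; elim: n u v => [u v _ /le_trans|n IH u v [f Gf <-] fv]; first exact.
move=> [g [k [Gg Gk gv ke c]]]; apply/(chainS _ _ Gf Gk ke).
have fg : V (f + k) <= V (g + k).
  by rewrite (V_add_le (measurableC mG) CG)// gv.
apply: (IH _ _ _ fg) => //.
apply: (@inJ_convex _ (V f) _ w) => //; first by exists f.
rewrite (le_trans fg (chain_le c)) andbT ltW// addrC.
by rewrite (@V_add_gt G (~` G))// ?setICr// ke.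
Qed.

Lemma chain_cat n m u v w : inJ (~` G) u -> inJ (~` G) v -> inJ (~` G) w ->
  chain G e n u v -> chain G e m v w -> chain G e (n + m) u w.
Proof.
move=> + Jv Jw; elim: n u => [u Ju uv|n IH u Ju cu cv].
  exact: chain_wl.
have [x Jx [_ xP]] := chain_inJ Ju Jv cu.
by rewrite addSn; apply/xP/IH => //; apply/xP.
Qed.

(** The one step that may straddle [v] is lost, whence [j.+1]. *)
Lemma chain_split n u v w : inJ (~` G) u -> inJ (~` G) v -> inJ (~` G) w ->
  u <= v -> v <= w -> chain G e n u w ->
  exists i j, [/\ (n <= i + j.+1)%N, chain G e i u v & chain G e j v w].
Proof.
move=> + Jv Jw + vw; elim: n u => [|n IH] u Ju uv c; first by exists 0%N, 0%N.
have [x Jx [ux xP]] := chain_inJ Ju Jw c.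
have [xv|vx] := leP x v.
  have [i [j [ij ci cj]]] := IH x Jx xv ((xP _ _).1 c).
  by exists i.+1, j; split=> //; apply/xP.
exists 0%N, n; split=> //; apply: (chain_wl _ _ (ltW vx)) => //.
exact/xP.
Qed.

(** Let [s] be the supremum of the constants on the complement of [G] from which arbitrarily many
    steps fit below [w]. A step taken from such a constant close to [s] keeps this property and, by
    continuity, reaches a value above that of [s]. This value is again that of a constant, which
    would lie beyond [s]. *)
Lemma chain_arch v w : inJ (~` G) v -> inJ (~` G) w ->
  exists N, ~ chain G e N v w.
Proof.
move=> Jv Jw; apply: contrapT => /forallNP ch.
have {}ch n : chain G e n v w by exact: contrapT.
have [f [Lf sf] fv] := Jv; have [g [Lg sg] gw] := Jw.
have [M M0 fM] := LinfM Lf; have [N N0 gN] := LinfM Lg.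
have mCG := measurableC mG.
pose c1 := restr (~` G) (cstf 1) : T -> R.
have c1J : on (~` G) c1 by apply: on_restr => //; exact: Linf_cst.
pose c (x : R) := x \*o c1.
have Lc x : on (~` G) (c x) by exact: onZ.
have cin x p : ~ G p -> c x p = x.
  by move=> Gp; rewrite /c /= /c1 restr_in// /cstf mulr1.
have cnotin x p : G p -> c x p = 0.
  by move=> Gp; rewrite /c /= /c1 restr_notin ?mulr0//; apply.
have cmono x y : x <= y -> V (c x) <= V (c y).
  move=> xy; apply: Vmono; [exact: (Lc x).1|exact: (Lc y).1|move=> p].
  by have [Gp|Gp] := pselect (G p); rewrite ?(cnotin _ _ Gp)// !cin.
have vM : V (c (- M)) <= v.
  rewrite -fv; apply: Vmono => //; first exact: (Lc _).1.
  move=> p; have [Gp|Gp] := pselect (G p).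
    by rewrite cnotin// sf//; apply.
  by rewrite cin//; have := fM p; rewrite ler_norml => /andP[].
have wN : w <= V (c N).
  rewrite -gw; apply: Vmono => //; first exact: (Lc _).1.
  move=> p; have [Gp|Gp] := pselect (G p).
    by rewrite cnotin// sg//; apply.
  by rewrite cin//; have := gN p; rewrite ler_norml => /andP[].
have [k Gk ke] := Ge.
pose S := [set x | x <= N /\ forall n, chain G e n (V (c x)) w].
have SM : S (- M).
  split; first by rewrite (le_trans _ N0)// oppr_le0.
  by move=> n; apply: (chain_wl _ _ vM (ch n)) => //; exists (c (- M)).
have hS : has_sup S by split; [exists (- M)|exists N => x []].
pose s := sup S.
have sk : V (c s) < V (k + c s).
  by rewrite (@V_add_gt G (~` G))// ?setICr// ke.
have [dl dl0 sd] : exists2 dl : R, 0 < dl &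
    forall x, `|s - x| < dl -> V (c s) < V (k + c x).
  have /cvgrPdist_lt/(_ (V (k + c s) - V (c s))) := @V_path _ _ Gk.1 c1J.1 s.
  rewrite subr_gt0 => /(_ sk)/nbhs_ballP[dl /= dl0 h]; exists dl => // x sx.
  have := h x sx; rewrite /= ltr_norml => /andP[_]; rewrite /c; lra.
have [x Sx sx] := sup_adherent dl0 hS.
have xs : x <= s by apply: ub_le_sup => //; exact: hS.2.
have {sd} := sd x; rewrite ger0_norm ?subr_ge0// ltrBlDr -ltrBlDl => /(_ sx) sd.
have cx n : chain G e n (V (k + c x)) w.
  by rewrite addrC; apply/(chainS _ _ (Lc x) Gk ke)/Sx.2.
have [||||y /andP[xy yN] yk] := @V_IVT 0 c1 x N (V (k + c x)) => //.
- exact: (on0 G).1.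
- exact: c1J.1.
- exact: Sx.1.
- rewrite !add0r (le_trans (cx 0%N) wN) andbT.
  exact: le_trans (cmono _ _ xs) (ltW sd).
rewrite add0r in yk.
have ys : y <= s.
  by apply: ub_le_sup; [exact: hS.2|split=> // n; rewrite /c yk].
by have := cmono _ _ ys; rewrite /c yk leNgt sd.
Qed.

(** For [w < v] the set is empty and its supremum is 0, which lets [scnt] treat both orders by one
    difference. *)
Definition cnt v w : R := sup [set n%:R | n in [set n | chain G e n v w]].

Lemma cnt_gt v w : w < v -> cnt v w = 0.
Proof.
move=> wv; rewrite /cnt (_ : [set n | _] = set0) ?image_set0 ?sup0//.
by apply/seteqP; split=> // n /= /chain_le; rewrite leNgt wv.
Qed.

Lemma cnt_ge n v w : inJ (~` G) v -> inJ (~` G) w -> chain G e n v w ->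
  n%:R <= cnt v w.
Proof.
move=> Jv Jw c; have [N cN] := chain_arch Jv Jw; apply: ub_le_sup; last by exists n.
exists N%:R => _ [m /= cm <-]; rewrite ler_nat leqNgt; apply/negP => Nm.
apply: cN; elim: m Nm cm => // m IH; rewrite ltnS leq_eqVlt.
have step : chain G e m.+1 v w -> chain G e m v w.
  move=> c1; have [x Jx [vx xP]] := chain_inJ Jv Jw c1.
  by apply: (chain_wl _ _ (ltW vx)) => //; exact/xP.
by move=> /orP[/eqP -> //|/IH + /step].
Qed.

Lemma cnt_le v w (b : R) : v <= w ->
  (forall n, chain G e n v w -> n%:R <= b) -> cnt v w <= b.
Proof.
move=> vw h; apply: ge_sup; first by exists 0; exists 0%N.
by move=> _ [n /= /h + <-].
Qed.

Lemma cnt_ge0 v w : inJ (~` G) v -> inJ (~` G) w -> 0 <= cnt v w.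
Proof.
by move=> Jv Jw; have [/(cnt_ge (n := 0) Jv Jw)|/cnt_gt ->] := leP v w.
Qed.

Lemma cnt_super u v w : inJ (~` G) u -> inJ (~` G) v -> inJ (~` G) w ->
  u <= v -> v <= w -> cnt u v + cnt v w <= cnt u w.
Proof.
move=> Ju Jv Jw uv vw; rewrite -lerBrDr; apply: cnt_le => // n cn.
rewrite lerBrDr addrC -lerBrDr; apply: cnt_le => // m cm.
by rewrite lerBrDr -natrD addnC; apply: cnt_ge => //; exact: chain_cat cm.
Qed.

Lemma cnt_sub u v w : inJ (~` G) u -> inJ (~` G) v -> inJ (~` G) w ->
  u <= v -> v <= w -> cnt u w <= cnt u v + cnt v w + 1.
Proof.
move=> Ju Jv Jw uv vw; apply: cnt_le; first exact: le_trans vw.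
move=> n cn; have [i [j [ij ci cj]]] := chain_split Ju Jv Jw uv vw cn.
apply: (@le_trans _ _ (i%:R + j%:R + 1)).
  by rewrite -natrD natr1 ler_nat -addnS.
by rewrite lerD2r lerD// cnt_ge.
Qed.

Definition scnt v w := cnt v w - cnt w v.

Lemma scntC v w : scnt w v = - scnt v w.
Proof. by rewrite /scnt opprB. Qed.

Lemma scntE v w : inJ (~` G) v -> v <= w -> scnt v w = cnt v w.
Proof.
move=> Jv; rewrite le_eqVlt /scnt => /orP[/eqP <-|vw].
  rewrite subrr; apply/eqP; rewrite eq_le cnt_ge0//=.
  apply: cnt_le => // -[|n]//= cn.
  have [x _ [vx xP]] := chain_inJ Jv Jv cn.
  by have /chain_le := (xP _ _).1 cn; rewrite leNgt vx.
by rewrite (cnt_gt vw) subr0.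
Qed.

Lemma scnt_ge0 v w : inJ (~` G) v -> inJ (~` G) w -> v <= w -> 0 <= scnt v w.
Proof. by move=> Jv Jw vw; rewrite scntE// cnt_ge0. Qed.

(** All orders of the three values reduce to the sorted one; the error 1 is the straddling step of
    [cnt_sub]. *)
Lemma scnt_triangle u v w : inJ (~` G) u -> inJ (~` G) v -> inJ (~` G) w ->
  `|scnt u v + scnt v w - scnt u w| <= 1.
Proof.
have sorted x y z : inJ (~` G) x -> inJ (~` G) y -> inJ (~` G) z ->
    x <= y -> y <= z ->
    scnt x y + scnt y z <= scnt x z <= scnt x y + scnt y z + 1.
  move=> Jx Jy Jz xy yz; have xz := le_trans xy yz.
  by rewrite !scntE// cnt_super// cnt_sub.
move=> Ju Jv Jw; have := scntC u v; have := scntC v w; have := scntC u w.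
rewrite ler_norml.
have [uv|/ltW vu] := leP u v; have [vw|/ltW wv] := leP v w;
  have [uw|/ltW wu] := leP u w.
- by have := sorted _ _ _ Ju Jv Jw uv vw; lra.
- by have := sorted _ _ _ Ju Jv Jw uv vw; lra.
- by have := sorted _ _ _ Ju Jw Jv uw wv; lra.
- by have := sorted _ _ _ Jw Ju Jv wu uv; lra.
- by have := sorted _ _ _ Jv Ju Jw vu uw; lra.
- by have := sorted _ _ _ Jv Jw Ju vw wu; lra.
- by have := sorted _ _ _ Jw Jv Ju wv vu; lra.
- by have := sorted _ _ _ Jw Jv Ju wv vu; lra.
Qed.

End gauge.

(** * Independence of the counts from the realization and from the event carrying the steps *)

Lemma setI_subsetC (A B : set T) : A `&` B = set0 -> A `<=` ~` B.
Proof. by move=> AB; apply/disjoints_subset. Qed.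

(** Each step from [k] is matched with one from [h + k], and the value reached is realized again on
    [D] before the induction continues. *)
Lemma chain_shift D E G e n h k k' : measurable D -> measurable E ->
  D `&` E = set0 -> D `&` G = set0 -> E `&` G = set0 ->
  gauge G e -> on D k -> on D k' -> on E h ->
  chain G e n (V k) (V k') <-> chain G e n (V (h + k)) (V (h + k')).
Proof.
move=> mD mE DE DG EG Hg Dk Dk' Eh; have [mG e0 [g Gg ge]] := Hg.
have mDG : measurable (D `|` G) by exact: measurableU.
have DGE : (D `|` G) `&` E = set0 by rewrite setIUl DE setIC EG setU0.
have DCG := setI_subsetC DG; have ECG := setI_subsetC EG.
elim: n k Dk => [|n IH] k Dk; first by rewrite /= ![h + _]addrC (V_add_le mD DE).
have Hk : on (~` G) (h + k) by apply: onD; [apply: onS Eh|apply: onS Dk].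
rewrite (chainS Hg _ _ _ Gg ge)//; last exact: onS Dk.
rewrite (chainS Hg _ _ Hk Gg ge).
have shift x : on D x -> (V (k + g) <= V x) = (V (h + k + g) <= V (h + x)).
  move=> Dx; rewrite -addrA ![h + _]addrC (V_add_le mDG DGE)//; first exact: onU.
  by apply: onS Dx; exact: subsetUl.
have kg : V k < V (k + g).
  by rewrite addrC (@V_add_gt G D)// ?ge// setIC.
(* Either chain forces [V (k + g) <= V k'], and this bound makes the value reached attainable on
   [D]. *)
suff lift : V (k + g) <= V k' ->
    chain G e n (V (k + g)) (V k') <-> chain G e n (V (h + k + g)) (V (h + k')).
  split=> c; first by apply/lift => //; exact: (chain_le Hg c).
  by apply/lift => //; rewrite shift//; exact: (chain_le Hg c).
move=> kgk'.
have [x Dx xkg] : inJ D (V (k + g)).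
  apply: (@inJ_convex _ (V k) _ (V k')); [by exists k|by exists k'|].
  by rewrite (ltW kg).
rewrite -xkg -addrA [h + (_ + _)]addrC.
rewrite -(V_add_eq mDG DGE _ _ Eh xkg) ?[x + h]addrC; first exact: IH.
  by apply: onS Dx; exact: subsetUl.
exact: onU.
Qed.

(** Steps of equal worth on [G] and on [H] lead from [k] to the same value, which is realized on
    [D]. *)
Lemma chain_gauge D G H e n k k' : measurable D -> D `&` G = set0 -> D `&` H = set0 -> G `&` H = set0 ->
  gauge G e -> gauge H e -> on D k -> on D k' ->
  chain G e n (V k) (V k') -> chain H e n (V k) (V k').
Proof.
move=> mD DG DH GH HG HH Dk Dk'; have [mG e0 [g Gg ge]] := HG.
have [mH _ [h Hh he]] := HH.
have DCG := setI_subsetC DG; have DCH := setI_subsetC DH.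
have mGH : measurable (G `|` H) by exact: measurableU.
have GHD : (G `|` H) `&` D = set0 by rewrite setIUl setIC DG setIC DH setU0.
elim: n k Dk => [//|n IH] k Dk.
rewrite (chainS HG _ _ _ Gg ge) ?(chainS HH _ _ _ Hh he)//;
  try exact: onS Dk.
move=> c; have kg : V k < V (k + g).
  by rewrite addrC (@V_add_gt G D)// ?ge// setIC.
have [x Dx xkg] : inJ D (V (k + g)).
  apply: (@inJ_convex _ (V k) _ (V k')); [by exists k|by exists k'|].
  by rewrite (ltW kg) (chain_le HG c).
have -> : V (k + h) = V x.
  rewrite xkg ![k + _]addrC; apply: (V_add_eq mGH GHD) => //; last by rewrite he.
    by apply: onS Hh; exact: subsetUr.
  by apply: onS Gg; exact: subsetUl.
by apply: IH => //; rewrite xkg.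
Qed.

Lemma cnt_shift D E G e h k k' : measurable D -> measurable E ->
  D `&` E = set0 -> D `&` G = set0 -> E `&` G = set0 ->
  gauge G e -> on D k -> on D k' -> on E h ->
  cnt G e (V (h + k)) (V (h + k')) = cnt G e (V k) (V k').
Proof.
move=> mD mE DE DG EG Hg Dk Dk' Eh; rewrite /cnt.
suff -> : [set n | chain G e n (V (h + k)) (V (h + k'))] =
          [set n | chain G e n (V k) (V k')] by [].
by apply/seteqP; split=> n /= /(chain_shift n mD mE DE DG EG Hg Dk Dk' Eh).
Qed.

Lemma scnt_shift D E G e h k k' : measurable D -> measurable E ->
  D `&` E = set0 -> D `&` G = set0 -> E `&` G = set0 ->
  gauge G e -> on D k -> on D k' -> on E h ->
  scnt G e (V (h + k)) (V (h + k')) = scnt G e (V k) (V k').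
Proof.
move=> mD mE DE DG EG Hg Dk Dk' Eh.
by rewrite /scnt !(cnt_shift mD mE DE DG EG Hg _ _ Eh).
Qed.

Lemma cnt_gauge D G H e v w : measurable D -> D `&` G = set0 ->
  D `&` H = set0 -> G `&` H = set0 -> gauge G e -> gauge H e ->
  inJ D v -> inJ D w -> cnt G e v w = cnt H e v w.
Proof.
move=> mD DG DH GH HG HH [k Dk <-] [k' Dk' <-]; rewrite /cnt.
suff -> : [set n | chain G e n (V k) (V k')] =
          [set n | chain H e n (V k) (V k')] by [].
apply/seteqP; split=> n /=.
  exact: (chain_gauge mD DG DH GH HG HH).
by apply: (chain_gauge mD DH DG _ HH HG) => //; rewrite setIC.
Qed.

Lemma cnt_step D E G e k h : measurable D -> measurable E ->
  D `&` E = set0 -> D `&` G = set0 -> E `&` G = set0 ->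
  gauge G e -> on D k -> on E h ->
  cnt G e (V k) (V (k + h)) = cnt G e 0 (V h).
Proof.
move=> mD mE DE DG EG Hg Dk Eh.
rewrite -[in LHS](addr0 k) -V0 -[RHS](cnt_shift mE mD _ EG DG Hg _ _ Dk)//.
- by rewrite addr0.
- by rewrite setIC.
- exact: on0.
Qed.

Lemma cnt_mono D G e u v w : D `&` G = set0 -> gauge G e ->
  inJ D u -> inJ D v -> inJ D w -> u <= v -> v <= w ->
  cnt G e u v <= cnt G e u w.
Proof.
move=> /setI_subsetC DG Hg /(inJS DG) Ju /(inJS DG) Jv /(inJS DG) Jw uv vw.
by rewrite (le_trans _ (cnt_super Hg Ju Jv Jw uv vw))// lerDl cnt_ge0.
Qed.

Lemma inJ_step D E k h : measurable E -> D `&` E = set0 -> on D k -> on E h ->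
  0 < V h -> forall w, inJ D w -> V (k + h) <= w -> inJ D (V (k + h)).
Proof.
move=> mE DE Dk Eh h0 w Jw khw; apply: (@inJ_convex _ (V k) _ w) => //.
  by exists k.
by rewrite khw andbT ltW// addrC (@V_add_gt E D)// setIC.
Qed.

Lemma inJU D E k h : on D k -> on E h -> inJ (D `|` E) (V (k + h)).
Proof. by move=> Dk Eh; exists (k + h) => //; exact: onU. Qed.

(** * Comparison of fine and coarse steps *)

Section coarse.
Variables (D E G : set T) (dl : R).
Hypotheses (mD : measurable D) (DE : D `&` E = set0) (DG : D `&` G = set0)
  (EG : E `&` G = set0) (Hdl : gauge E dl).

Let mE : measurable E. Proof. by case: Hdl. Qed.

(** [K] bounds the number of coarse steps of size [dl] and does not depend on [e]; each of them
    costs [cnt G e 0 dl], plus 1 for a straddling fine step. *)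
Lemma cnt_ratio v w : inJ D v -> inJ D w -> v <= w ->
  exists K : nat, forall e, gauge G e ->
    cnt G e v w <= K%:R * (cnt G e 0 dl + 1).
Proof.
move=> Jv Jw; have [_ dl0 [h Eh hdl]] := Hdl.
have [K cK] := chain_arch Hdl (inJS (setI_subsetC DE) Jv) (inJS (setI_subsetC DE) Jw).
move=> vw; exists K => e He; have DCG := setI_subsetC DG.
have DUG : (D `|` E) `&` G = set0 by rewrite setIUl DG EG setU0.
have dge0 : 0 <= cnt G e 0 dl.
  apply: cnt_ge0 => //; first exact: inJ0.
  by exists h => //; apply: onS Eh; exact: setI_subsetC.
elim: K v Jv cK vw => [//|K IH] v [k Dk <-] cK kw.
rewrite (chainS Hdl K w (onS (setI_subsetC DE) Dk) Eh hdl) in cK.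
have step := cnt_step mD mE DE DG EG He Dk Eh; rewrite hdl in step.
have [khw|wkh] := leP (V (k + h)) w.
  have Jkh : inJ D (V (k + h)).
    by apply: (inJ_step mE DE Dk Eh _ Jw khw); rewrite hdl.
  have := IH _ Jkh cK khw.
  have := cnt_sub He (inJS DCG (ex_intro2 _ _ k Dk erefl)) (inJS DCG Jkh) (inJS DCG Jw).
  rewrite step => /(_ _ khw); rewrite addrC ltW ?(@V_add_gt E D)// ?hdl 1?setIC//.
  by move=> /(_ isT); rewrite addrC -natr1 mulrDl mul1r => h1 h2; lra.
(* The last coarse step overshoots [w], so monotonicity of the count is enough. *)
have Jw' : inJ (D `|` E) w by apply: inJS Jw; exact: subsetUl.
have := cnt_mono DUG He _ Jw' (inJU Dk Eh) kw (ltW wkh).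
rewrite step => /(_ _)/le_trans; apply.
  by exists k => //; apply: onS Dk; exact: subsetUl.
rewrite -natr1 mulrDl mul1r ler_wpDl ?lerDl//.
by rewrite mulr_ge0 ?ler0n// addr_ge0.
Qed.

Lemma chain_cnt e m v w : gauge G e -> inJ D v -> inJ D w ->
  chain E dl m v w -> m%:R * cnt G e 0 dl <= cnt G e v w.
Proof.
move=> He Jv Jw; have [_ dl0 [h Eh hdl]] := Hdl; have DCG := setI_subsetC DG.
elim: m v Jv => [|m IH] v [k Dk <-] c.
  by rewrite mul0r cnt_ge0//; apply: (inJS DCG) => //; exists k.
rewrite (chainS Hdl m w (onS (setI_subsetC DE) Dk) Eh hdl) in c.
have khw := chain_le Hdl c.
have Jkh : inJ D (V (k + h)).
  by apply: (inJ_step mE DE Dk Eh _ Jw khw); rewrite hdl.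
have := IH _ Jkh c.
have := cnt_super He (inJS DCG (ex_intro2 _ _ k Dk erefl)) (inJS DCG Jkh) (inJS DCG Jw).
rewrite (cnt_step mD mE DE DG EG He Dk Eh) hdl => /(_ _ khw).
rewrite addrC ltW ?(@V_add_gt E D)// ?hdl 1?setIC// => /(_ isT).
by rewrite -natr1 mulrDl mul1r addrC => h1 h2; lra.
Qed.

End coarse.

(** What is kept of non-nullness once the preference is replaced by [V]. *)
Definition fat D := measurable D /\
  forall x y : R, x < y -> V (restr D (cstf x)) < V (restr D (cstf y)).

(** A small positive constant on [D] works, by continuity of [V] along the segment starting at
    [k]. *)
Lemma fat_small D E k u : fat D -> on E k -> V k < u ->
  exists h, [/\ on D h, 0 < V h & V (k + h) <= u].
Proof.
move=> [mD fD] Ek ku; pose c1 : T -> R := restr D (cstf 1).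
have Dc1 : on D c1 by apply: on_restr => //; exact: Linf_cst.
have /cvgrPdist_le/(_ (u - V k)) := @V_path _ _ Ek.1 Dc1.1 0.
rewrite subr_gt0 => /(_ ku)/nbhs_ballP[x /= x0 /(_ (x / 2))].
have xb : ball 0 x (x / 2) by rewrite /ball /= sub0r normrN gtr0_norm; lra.
move=> /(_ xb); rewrite /= ler_norml => /andP[+ _].
have -> : k + 0 \*o c1 = k by apply/funext => p; rewrite addfE /= mul0r addr0.
move=> ck; exists ((x / 2) \*o c1); split; first exact: onZ.
  have -> : (x / 2) \*o c1 = restr D (cstf (x / 2)).
    by apply/funext => p; rewrite /= /c1 !restrE mul1r.
  rewrite -V0 -(restr0 D); apply: fD; rewrite divr_gt0//.
by lra.
Qed.

(** One step worth less than the increment [h] stays below the midpoint of [v] and [w]; the other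
    [m] fit above the midpoint by induction. *)
Lemma chain_many D G m v w : fat G -> D `&` G = set0 ->
  inJ D v -> inJ D w -> v < w ->
  exists2 eta : R, 0 < eta & forall e, gauge G e -> e < eta -> chain G e m v w.
Proof.
move=> fG DG + Jw; have DCG := setI_subsetC DG; have [mG _] := fG.
elim: m v => [|m IH] v Jv vw; first by exists 1 => // e _ _; exact: ltW.
pose u := (v + w) / 2.
have [vu uw] : v < u /\ u < w by rewrite /u; split; lra.
have Ju : inJ D u by apply: (inJ_convex Jv Jw); rewrite !ltW.
have [eta1 eta10 h1] := IH _ Ju uw.
have [k Dk kv] := Jv; rewrite -kv in vu *.
have [h [Gh h0 khu]] := fat_small fG Dk vu.
exists (Num.min eta1 (V h)); first by rewrite lt_min eta10.
move=> e He; rewrite lt_min => /andP[ee1 eh]; have [_ e0 [g Gg ge]] := He.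
apply/(chainS He _ _ (onS DCG Dk) Gg ge).
have kgu : V (k + g) <= u.
  apply: le_trans khu; rewrite ![k + _]addrC (@V_add_le G D)// ?ge ?ltW//.
  by rewrite setIC.
apply: (chain_wl He _ _ kgu (h1 _ He ee1)); last exact: inJS Jw.
apply: (inJS DCG); apply: (inJ_step mG DG Dk Gg _ Ju kgu).
by rewrite ge.
Qed.

(** * Normalized counts and their ultrafilter limit *)

Section triple.
Variables (U : set_system R).
Hypotheses (UU : UltraFilter U) (U0 : 0^'+ `<=` U).

Let UF : ProperFilter U. Proof. exact: ultra_proper. Qed.

(** The limit along [U] as the supremum of the eventual lower bounds, an expression defined for
    every [r]. *)
Definition ulim (r : R -> R) : R := sup [set x | U [set e | x <= r e]].

Lemma ulim_cvg (r : R -> R) (M : R) : (\forall e \near U, `|r e| <= M) ->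
  r e @[e --> U] --> ulim r.
Proof.
move=> rM; have hs : has_sup [set x | U [set e | x <= r e]].
  split.
    exists (- M) => /=; apply: filterS rM => e /=.
    by rewrite ler_norml => /andP[].
  exists M => x /= Ux; have [e [xe]] := filter_ex (filterI Ux rM).
  by rewrite /= ler_norml => /andP[_]; exact: le_trans.
apply/cvgrPdist_le => eps eps0.
have [x /= Ux xl] := sup_adherent eps0 hs; rewrite -/(ulim r) in xl.
(* [U] contains this set or its complement, and the complement would make [ulim r + eps] an eventual
   lower bound. *)
have Ur : U [set e | r e < ulim r + eps].
  have [] := @in_ultra_setVsetC _ U [set e | ulim r + eps <= r e] UU.
    by move=> /(ub_le_sup hs.2); rewrite -/(ulim r) gerDl leNgt eps0.
  by apply: filterS => e /= /negP; rewrite -ltNge.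
near=> e; rewrite ler_distlC; apply/andP; split.
  rewrite (le_trans (ltW xl))//; near: e; exact: Ux.
by apply: ltW; near: e; exact: Ur.
Unshelve. all: by end_near. Qed.

Variables (dl0 : R) (N : R -> R).
Hypothesis dl0_gt0 : 0 < dl0.

Definition phi G v := ulim (fun e => scnt G e 0 v / N e).

(** [D] and [E] carry the functions compared, [G] the steps. [N] is a parameter so that the triples
    obtained by exchanging roles share one normalization. *)
Record triple D E G : Prop := Triple {
  triple_fat : [/\ fat D, fat E & fat G];
  triple_disj : [/\ D `&` E = set0, D `&` G = set0 & E `&` G = set0];
  triple_dl0 : [/\ inJ D dl0, inJ E dl0 & inJ G dl0];
  triple_cnt : \forall e \near U, N e = cnt G e 0 dl0 }.

Lemma near_gauge G : measurable G -> inJ G dl0 -> \forall e \near U, gauge G e.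
Proof.
move=> mG JG; apply: U0; near=> e; have e0 : 0 < e by [].
split=> //; apply: (inJ_convex (inJ0 G) JG); rewrite ltW//=; near: e.
exact: nbhs_right_le.
Unshelve. all: by end_near. Qed.

Section in_triple.
Variables (D E G : set T).
Hypothesis HT : triple D E G.

Let fD : fat D. Proof. by case: HT => -[]. Qed.
Let fE : fat E. Proof. by case: HT => -[]. Qed.
Let fG : fat G. Proof. by case: HT => -[]. Qed.
Let mD : measurable D. Proof. exact: fD.1. Qed.
Let mE : measurable E. Proof. exact: fE.1. Qed.
Let mG : measurable G. Proof. exact: fG.1. Qed.
Let DE : D `&` E = set0. Proof. by case: HT => _ []. Qed.
Let DG : D `&` G = set0. Proof. by case: HT => _ []. Qed.
Let EG : E `&` G = set0. Proof. by case: HT => _ []. Qed.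
Let JD : inJ D dl0. Proof. by case: HT => _ _ []. Qed.
Let JE : inJ E dl0. Proof. by case: HT => _ _ []. Qed.
Let JG : inJ G dl0. Proof. by case: HT => _ _ []. Qed.
Let HN : \forall e \near U, N e = cnt G e 0 dl0. Proof. by case: HT. Qed.
Let DCG : D `<=` ~` G. Proof. exact: setI_subsetC. Qed.
Let ECG : E `<=` ~` G. Proof. exact: setI_subsetC. Qed.
Let gG : \forall e \near U, gauge G e. Proof. exact: near_gauge. Qed.

Lemma N_large (m : nat) : \forall e \near U, m%:R <= N e.
Proof.
have [eta eta0 h] := chain_many m fG DG (inJ0 D) JD dl0_gt0.
have Ueta : \forall e \near U, e < eta by apply: U0; exact: nbhs_right_lt.
near=> e; have -> : N e = cnt G e 0 dl0 by near: e.
have He : gauge G e by near: e.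
apply: (cnt_ge He); [exact: inJ0|exact: inJS JD|apply: h => //].
by near: e.
Unshelve. all: by end_near. Qed.

Lemma N_inv : (N e)^-1 @[e --> U] --> (0 : R).
Proof.
apply/cvgr0Pnorm_le => eps eps0.
near=> e.
have h : (Num.truncn eps^-1).+1%:R <= N e by near: e; exact: N_large.
have N0 : 0 < N e by apply: lt_le_trans h; rewrite ltr0n.
rewrite ger0_norm ?invr_ge0 ?(ltW N0)// -[leRHS]invrK lef_pV2 ?posrE ?invr_gt0//.
by rewrite (le_trans _ h)// ltW// truncnS_gt.
Unshelve. all: by end_near. Qed.

(** Where the single-step errors disappear: divided by [N e], they tend to 0. *)
Lemma cvg_defect (a c : R -> R) (l : R) : a e @[e --> U] --> l ->
  (\forall e \near U, `|a e - c e| <= (N e)^-1) -> c e @[e --> U] --> l.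
Proof.
move=> al ac; rewrite (_ : c = fun e => a e - (a e - c e)); last first.
  by apply/funext => e; rewrite opprB addrC subrK.
rewrite -[X in _ --> X]subr0; apply: cvgB => //.
apply/cvgr0Pnorm_le => eps eps0.
have /cvgr0Pnorm_le/(_ _ eps0) Ni := N_inv.
near=> e; apply: (@le_trans _ _ (N e)^-1); first by near: e.
by apply: (le_trans (ler_norm _)); near: e.
Unshelve. all: by end_near. Qed.

Lemma cnt_bounded v w : inJ D v -> inJ D w ->
  exists M, \forall e \near U, `|scnt G e v w / N e| <= M.
Proof.
wlog vw : v w / v <= w => [wl Jv Jw|Jv Jw].
  have [vw|/ltW wv] := leP v w; first exact: wl.
  have [M h] := wl _ _ wv Jw Jv; exists M; apply: filterS h => e.
  by rewrite (scntC G e v w) mulNr normrN.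
have gE : gauge E dl0 by split.
have [K hK] := cnt_ratio mD DE DG EG gE Jv Jw vw.
(* The factor 2 comes from [N e + 1 <= 2 * N e], valid once [1 <= N e]. *)
exists (K%:R * 2); near=> e.
have He : gauge G e by near: e.
have N1 : 1 <= N e by near: e; exact: (N_large 1).
have N0 : 0 < N e by rewrite (lt_le_trans _ N1).
have Jv' := inJS DCG Jv; have Jw' := inJS DCG Jw.
rewrite ger0_norm; last by rewrite divr_ge0 ?(ltW N0)// (scnt_ge0 He).
rewrite ler_pdivrMr// (scntE He)// (le_trans (hK _ He))// -mulrA ler_wpM2l//.
have -> : cnt G e 0 dl0 = N e by apply/esym; near: e.
by lra.
Unshelve. all: by end_near. Qed.

Lemma phi_cvg v : inJ D v -> scnt G e 0 v / N e @[e --> U] --> phi G v.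
Proof. by move=> Jv; have [M /ulim_cvg] := cnt_bounded (inJ0 D) Jv. Qed.

Lemma triangle_near (H : set T) u v w : H `&` G = set0 ->
  inJ H u -> inJ H v -> inJ H w -> \forall e \near U,
    `|scnt G e u v / N e + scnt G e v w / N e - scnt G e u w / N e| <= (N e)^-1.
Proof.
move=> /setI_subsetC HG Ju Jv Jw; near=> e.
have He : gauge G e by near: e.
have N1 : 1 <= N e by near: e; exact: (N_large 1).
have N0 : 0 < N e by rewrite (lt_le_trans _ N1).
rewrite -mulrDl -mulrBl normrM (ger0_norm (x := _^-1)) ?invr_ge0 ?(ltW N0)//.
by rewrite ler_piMl ?invr_ge0 ?(ltW N0)// scnt_triangle//; exact: inJS HG _.
Unshelve. all: by end_near. Qed.

Lemma scnt_cvg v w : inJ D v -> inJ D w ->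
  scnt G e v w / N e @[e --> U] --> phi G w - phi G v.
Proof.
move=> Jv Jw.
apply: (@cvg_defect (fun e => scnt G e 0 w / N e - scnt G e 0 v / N e)).
  by apply: cvgB; exact: phi_cvg.
have := triangle_near DG (inJ0 D) Jv Jw; apply: filterS => e h.
by move: h; rewrite !ler_norml; lra.
Qed.

Lemma phi_nondec v w : inJ D v -> inJ D w -> v <= w -> phi G v <= phi G w.
Proof.
move=> Jv Jw vw; rewrite -subr_ge0; apply: (cvgr_to_ge (scnt_cvg Jv Jw)).
near=> e; have He : gauge G e by near: e.
have N1 : 1 <= N e by near: e; exact: (N_large 1).
rewrite divr_ge0 ?(le_trans _ N1)// (scnt_ge0 He)//; exact: inJS DCG _.
Unshelve. all: by end_near. Qed.

(** Some increment [h] on [E] fits between [v] and [w], and boundedly many of its size exhaust the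
    unit [dl0], so a fixed fraction of [N e] fits between [v] and [w]. *)
Lemma phi_inc v w : inJ D v -> inJ D w -> v < w -> phi G v < phi G w.
Proof.
move=> [k Dk <-] Jw kw; have Jv : inJ D (V k) by exists k.
have [h [Eh h0 khw]] := fat_small fE Dk kw.
have gE : gauge E (V h) by split=> //; exists h.
have [K hK] := cnt_ratio mD DE DG EG gE (inJ0 D) JD (ltW dl0_gt0).
have Jkh := inJ_step mE DE Dk Eh h0 Jw khw.
have kkh : V k <= V (k + h) by rewrite addrC ltW// (@V_add_gt E D)// setIC.
(* [K.+1] keeps the denominator positive, and the factor 2 absorbs the [+ 1] of [cnt_ratio] when
   [N e] is at least [2 * K.+1]. *)
rewrite -subr_gt0; apply: (@lt_le_trans _ _ (1 / (2 * K.+1%:R))).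
  by rewrite divr_gt0// mulr_gt0// ltr0n.
apply: (cvgr_to_ge (scnt_cvg Jv Jw)); near=> e.
have He : gauge G e by near: e.
have N2 : (2 * K.+1)%:R <= N e by near: e; exact: N_large.
have K0 : 0 < K.+1%:R :> R by rewrite ltr0n.
have N0 : 0 < N e by rewrite (lt_le_trans _ N2)// ltr0n.
have NE : N e = cnt G e 0 dl0 by near: e.
rewrite ler_pdivlMr// (scntE He)//; [|exact: inJS DCG _|exact: ltW].
apply: le_trans (cnt_mono DG He Jv Jkh Jw kkh khw).
rewrite (cnt_step mD mE DE DG EG He Dk Eh).
have := hK _ He; rewrite -NE; rewrite natrM in N2.
have c0 : 0 <= cnt G e 0 (V h).
  by apply: (cnt_ge0 He); [exact: inJ0|exists h => //; exact: onS Eh].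
rewrite div1r invfM mulrAC -mulrA ler_pdivrMl// ler_pdivrMr//.
move: N2 c0; rewrite -natr1; move: (cnt G e 0 (V h)) => c N2 c0 h1.
by nra.
Unshelve. all: by end_near. Qed.

Lemma phi_add (D1 D2 : set T) k l : measurable D1 -> measurable D2 ->
  D1 `&` D2 = set0 -> D1 `<=` D -> D2 `<=` D -> on D1 k -> on D2 l ->
  phi G (V (k + l)) = phi G (V k) + phi G (V l).
Proof.
move=> m1 m2 D12 D1D D2D k1 l2.
have Jk : inJ D (V k) by exists k => //; exact: onS k1.
have Jl : inJ D (V l) by exists l => //; exact: onS l2.
have Jkl : inJ D (V (k + l)).
  by exists (k + l) => //; apply: onD; [exact: onS k1|exact: onS l2].
have sub D' : D' `<=` D -> D' `&` G = set0.
  by move=> D'D; apply/disjoints_subset; exact: subset_trans DCG.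
apply: (@cvg_unique _ (@norm_hausdorff _ R) _ _ _ _ (phi_cvg Jkl)).
apply: (cvg_defect (cvgD (phi_cvg Jk) (phi_cvg Jl))).
have tr := triangle_near DG (inJ0 D) Jk Jkl.
near=> e; have He : gauge G e by near: e.
have <- : scnt G e (V k) (V (k + l)) = scnt G e 0 (V l).
  rewrite -V0 -[in LHS](addr0 k) -addrA add0r.
  apply: (scnt_shift m2 m1 _ (sub _ D2D) (sub _ D1D)) => //; first by rewrite setIC.
  exact: on0.
by near: e.
Unshelve. all: by end_near. Qed.

(** [h] is so small that [m] steps of its worth fit into the unit; [phi] then grows by at most
    [m%:R^-1] along any of them, whatever the starting function [k]. *)
Lemma phi_small (eta : R) : 0 < eta -> exists h, [/\ on E h, 0 < V h &
  forall k w, on D k -> inJ D w -> V k <= w -> w <= V (k + h) ->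
    phi G w - phi G (V k) <= eta].
Proof.
move=> eta0; pose m := (Num.truncn eta^-1).+1.
have m0 : 0 < m%:R :> R by rewrite ltr0n.
have meta : m%:R^-1 <= eta.
  by rewrite -[leRHS]invrK lef_pV2 ?posrE ?invr_gt0// ltW// truncnS_gt.
have [x x0 hx] := chain_many m fE DE (inJ0 D) JD dl0_gt0.
have [|h [Eh h0 hx2]] := @fat_small E D 0 (Num.min x dl0 / 2) fE (on0 D).
  by rewrite V0 divr_gt0 ?lt_min ?x0.
rewrite add0r in hx2.
have gE : gauge E (V h) by split=> //; exists h.
exists h; split=> // k w Dk Jw kw wkh.
have Jk : inJ D (V k) by exists k.
apply: le_trans meta; apply: (cvgr_to_le (scnt_cvg Jk Jw)).
have DUG : (D `|` E) `&` G = set0 by rewrite setIUl DG EG setU0.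
near=> e; have He : gauge G e by near: e.
have N1 : 1 <= N e by near: e; exact: (N_large 1).
have N0 : 0 < N e by rewrite (lt_le_trans _ N1).
have NE : N e = cnt G e 0 dl0 by near: e.
rewrite (scntE He) ?ler_pdivrMr//; last exact: inJS DCG _.
have hlt : V h < x.
  apply: (le_lt_trans hx2); rewrite ltr_pdivrMr//.
  by rewrite (@le_lt_trans _ _ x) ?ge_min ?lexx// ltr_pMr// ltr1n.
have := chain_cnt mD DE DG EG gE He (inJ0 D) JD (hx _ gE hlt).
rewrite -NE mulrC -ler_pdivlMr// mulrC; apply: le_trans.
rewrite -(cnt_step mD mE DE DG EG He Dk Eh).
apply: (cnt_mono DUG He _ _ (inJU Dk Eh)) => //.
  by apply: inJS Jk; exact: subsetUl.
by apply: inJS Jw; exact: subsetUl.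
Unshelve. all: by end_near. Qed.

(** Eventually [V (ks n)] and [V k] are within the increment [h] of each other. The smaller one may
    belong to [ks n], which is why [phi_small] has to be uniform in the starting function. *)
Lemma phi_continuous (ks : nat -> T -> R) k (M : R) : (forall n, on D (ks n)) ->
  on D k -> (forall n p, `|ks n p| <= M) ->
  (forall p, (fun n => ks n p) @ \oo --> k p) ->
  phi G (V (ks n)) @[n --> \oo] --> phi G (V k).
Proof.
move=> Dks Dk ksM ksk; apply/cvgrPdist_le => eta eta0.
have [h [Eh h0 hP]] := phi_small eta0.
have [Mh Mh0 hM] := LinfM Eh.1.
have kh0 : V k < V (k + h) by rewrite addrC (@V_add_gt E D)// setIC.
have c1 : V (ks n) @[n --> \oo] --> V k.
  by apply: (Vcvg _ _ ksM) => //; [move=> n; exact: (Dks n).1|exact: Dk.1].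
have c2 : V (ks n + h) @[n --> \oo] --> V (k + h).
  apply: (@Vcvg (fun n => ks n + h) _ (M + Mh)).
  - by move=> n; apply: LinfD; [exact: (Dks n).1|exact: Eh.1].
  - by apply: LinfD; [exact: Dk.1|exact: Eh.1].
  - by move=> n w; rewrite addfE (le_trans (ler_normD _ _))// lerD.
  - by move=> w; apply: cvgD => //; exact: cvg_cst.
near=> n.
have n1 : V (ks n) <= V (k + h) by near: n; exact: (cvgr_le _ c1).
have n2 : V k <= V (ks n + h) by near: n; exact: (cvgr_ge _ c2).
have Jn : inJ D (V (ks n)) by exists (ks n).
have Jk : inJ D (V k) by exists k.
have [kn|/ltW nk] := leP (V k) (V (ks n)).
  by rewrite distrC ger0_norm ?subr_ge0 ?phi_nondec// hP.
by rewrite ger0_norm ?subr_ge0 ?phi_nondec// hP.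
Unshelve. all: by end_near. Qed.

End in_triple.

Lemma tripleC D E G : triple D E G -> triple E D G.
Proof.
by case=> -[? ? ?] [? ? ?] [? ? ?] ?; split=> //; split=> //; rewrite setIC.
Qed.

(** The two pairs are joined through [a + b'], so that each leg changes one coordinate only and
    [scnt_shift] removes the other. *)
Lemma phi_pair D E G a a' b b' : triple D E G -> on D a -> on D a' ->
  on E b -> on E b' -> V (a' + b') <= V (a + b) ->
  phi G (V a') + phi G (V b') <= phi G (V a) + phi G (V b).
Proof.
move=> HT Da Da' Eb Eb' le.
have [[fD fE fG] [DE DG EG] [JD JE JG] HN] := HT.
have [mD mE mG] := And3 fD.1 fE.1 fG.1.
have Ja : inJ D (V a) by exists a.
have Ja' : inJ D (V a') by exists a'.
have Jb : inJ E (V b) by exists b.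
have Jb' : inJ E (V b') by exists b'.
rewrite -subr_ge0.
have -> : phi G (V a) + phi G (V b) - (phi G (V a') + phi G (V b')) =
  (phi G (V a) - phi G (V a')) + (phi G (V b) - phi G (V b')) + 0 by ring.
apply: (cvgr_to_ge (cvgD (cvgD (scnt_cvg HT Ja' Ja)
  (scnt_cvg (tripleC HT) Jb' Jb)) (N_inv HT))).
have DUG : (D `|` E) `&` G = set0 by rewrite setIUl DG EG setU0.
have tr := triangle_near HT DUG (inJU Da' Eb') (inJU Da Eb') (inJU Da Eb).
have gG := near_gauge mG JG.
near=> e; have He : gauge G e by near: e.
have N1 : 1 <= N e by near: e; exact: (N_large HT 1).
have : `|scnt G e (V (a' + b')) (V (a + b')) / N e +
  scnt G e (V (a + b')) (V (a + b)) / N e - scnt G e (V (a' + b')) (V (a + b)) / N e|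
  <= (N e)^-1 by near: e.
rewrite (scnt_shift mE mD _ EG DG)// 1?setIC//.
rewrite ![_ + b']addrC (scnt_shift mD mE DE DG EG)//.
have : 0 <= scnt G e (V (b' + a')) (V (a + b)) / N e.
  rewrite divr_ge0 ?(le_trans _ N1)// (scnt_ge0 He)//; last by rewrite addrC.
    by rewrite addrC; apply: inJS (inJU Da' Eb'); exact: setI_subsetC.
  by apply: inJS (inJU Da Eb); exact: setI_subsetC.
rewrite ler_norml => h1 /andP[h2 _].
change (0 <= scnt G e (V a') (V a) / N e + scnt G e (V b') (V b) / N e + (N e)^-1).
by lra.
Unshelve. all: by end_near. Qed.

Lemma phi_gauge D G H v : measurable D -> measurable G -> measurable H ->
  D `&` G = set0 -> D `&` H = set0 -> G `&` H = set0 ->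
  inJ G dl0 -> inJ H dl0 -> inJ D v -> phi G v = phi H v.
Proof.
move=> mD mG mH DG DH GH JG JH Jv; rewrite /phi /ulim.
suff E x : U [set e | x <= scnt G e 0 v / N e] = U [set e | x <= scnt H e 0 v / N e].
  by congr sup; apply/seteqP; split=> x /=; rewrite E.
have gGH : \forall e \near U, scnt G e 0 v = scnt H e 0 v.
  have gG := near_gauge mG JG; have gH := near_gauge mH JH.
  near=> e; have HG : gauge G e by near: e.
  have HH : gauge H e by near: e.
  by rewrite /scnt !(cnt_gauge mD DG DH GH HG HH)//; exact: inJ0.
by apply/propext; split=> h; apply: filterS (filterI h gGH) => e /= [+ eq];
  rewrite eq.
Unshelve. all: by end_near. Qed.

End triple.

(** * From two coordinates to three *)

Definition pairwise_mono D E (p q : R -> R) := forall a a' b b',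
  on D a -> on D a' -> on E b -> on E b' -> V (a' + b') <= V (a + b) ->
  p (V a') + q (V b') <= p (V a) + q (V b).

(* The coordinate moving in the favourable direction pays for the other one,
   until one of the two has reached its target. *)
Lemma mono3_opposite D E G (p q r : R -> R) x x' y y' z z' :
  measurable D -> measurable E -> measurable G ->
  D `&` E = set0 -> D `&` G = set0 -> E `&` G = set0 ->
  pairwise_mono D E p q -> pairwise_mono D G p r -> pairwise_mono E G q r ->
  on D x -> on D x' -> on E y -> on E y' -> on G z -> on G z' ->
  V x' <= V x -> V y <= V y' -> V (x' + y' + z') <= V (x + y + z) ->
  p (V x') + q (V y') + r (V z') <= p (V x) + q (V y) + r (V z).
Proof.
move=> mD mE mG DE DG EG pq pr qr Dx Dx' Ey Ey' Gz Gz' xx yy h.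
have ED : E `&` D = set0 by rewrite setIC.
have DUG : (D `|` E) `&` G = set0 by rewrite setIUl DG EG setU0.
have mDE := measurableU _ _ mD mE.
have [le|/ltW le] := leP (V (x' + y')) (V (x + y)).
  have [|c Dc cE] := @V_between D x' x y' (V (x + y)) Dx' Dx Ey'.1.
    by rewrite le/= ![x + _]addrC (V_add_le mE ED).
  have h1 := pq _ _ _ _ Dx Dc Ey Ey'; rewrite cE lexx in h1.
  have e1 := V_add_eq mDE DUG (onU Dc Ey') (onU Dx Ey) Gz cE.
  have h2 : V (x' + z') <= V (c + z).
    rewrite -(@V_add_le (D `|` G) E _ _ y')//; try exact: onU.
    - by rewrite addrAC [c + z + y']addrAC e1.
    - exact: measurableU.
    - by rewrite setIUl DE setIC EG setU0.
  have := pr _ _ _ _ Dc Dx' Gz Gz' h2; have := h1 isT; lra.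
have [|c Ec cE] := @V_between E y y' x' (V (x + y)) Ey Ey' Dx'.1.
  by rewrite ![_ + x']addrC le andbT (V_add_le mD DE).
rewrite addrC in cE.
have h1 := pq _ _ _ _ Dx Dx' Ey Ec; rewrite cE lexx in h1.
have e1 := V_add_eq mDE DUG (onU Dx' Ec) (onU Dx Ey) Gz cE.
have h2 : V (y' + z') <= V (c + z).
  rewrite -(@V_add_le (E `|` G) D _ _ x')//; try exact: onU.
  - by rewrite addrC addrA [c + z + x']addrC addrA e1.
  - exact: measurableU.
  - by rewrite setIC setIUr DE DG setU0.
have := qr _ _ _ _ Ec Ey' Gz Gz' h2; have := h1 isT; lra.
Qed.

Lemma pairwise_monoC D E p q : pairwise_mono D E p q -> pairwise_mono E D q p.
Proof.
move=> pq a a' b b' Ea Ea' Db Db' h; rewrite ![q _ + _]addrC; apply: pq => //.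
by rewrite addrC [b + a]addrC.
Qed.

(** Three improvements add up and three strict losses contradict the assumption. Any other pattern
    contains two opposite moves, which a permutation brings to the first two places of
    [mono3_opposite]. *)
Lemma mono3 D E G (p q r : R -> R) x x' y y' z z' :
  measurable D -> measurable E -> measurable G ->
  D `&` E = set0 -> D `&` G = set0 -> E `&` G = set0 ->
  pairwise_mono D E p q -> pairwise_mono D G p r -> pairwise_mono E G q r ->
  on D x -> on D x' -> on E y -> on E y' -> on G z -> on G z' ->
  V (x' + y' + z') <= V (x + y + z) ->
  p (V x') + q (V y') + r (V z') <= p (V x) + q (V y) + r (V z).
Proof.
move=> mD mE mG DE DG EG pq pr qr Dx Dx' Ey Ey' Gz Gz' h.
have [ED GD GE] : [/\ E `&` D = set0, G `&` D = set0 & G `&` E = set0].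
  by split; rewrite setIC.
have [qp rp rq] := And3 (pairwise_monoC pq) (pairwise_monoC pr) (pairwise_monoC qr).
have mono D' E' p' q' a a' : pairwise_mono D' E' p' q' -> on D' a -> on D' a' ->
    V a' <= V a -> p' (V a') <= p' (V a).
  move=> pq' Da Da' aa; have := pq' a a' 0 0 Da Da' (on0 E') (on0 E').
  by rewrite !addr0 => /(_ aa); rewrite lerD2r.
have swap12 (a b c : T -> R) : a + b + c = b + a + c by rewrite (addrC a).
have swap23 (a b c : T -> R) : a + b + c = a + c + b by rewrite addrAC.
have rot' (a b c : T -> R) : a + b + c = b + c + a by rewrite -addrA addrC.
have [xx|xx] := leP (V x') (V x); have [yy|yy] := leP (V y') (V y).
- have [zz|/ltW zz] := leP (V z') (V z).
    by rewrite !lerD//; [exact: mono pq _ _ _|exact: mono qr _ _ _|exact: mono rp _ _ _].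
  rewrite addrAC [leRHS]addrAC.
  apply: (mono3_opposite mD mG mE) => //; by rewrite (swap23 _ z') (swap23 _ z).
- by apply: (mono3_opposite mD mE mG) => //; exact: ltW.
- rewrite [p (V x') + _]addrC [p (V x) + _]addrC.
  apply: (mono3_opposite mE mD mG) => //; first exact: ltW.
  by rewrite (swap12 y') (swap12 y).
- have [zz|zz] := leP (V z') (V z).
    rewrite addrC addrA [leRHS]addrC [leRHS]addrA.
    apply: (mono3_opposite mG mD mE) => //; first exact: ltW.
    by rewrite (rot' z') (rot' z).
  exfalso; move: h; apply/negP; rewrite -ltNge.
  have mDE := measurableU _ _ mD mE.
  have DUG : (D `|` E) `&` G = set0 by rewrite setIUl DG EG setU0.
  have lt1 : V (x + y) < V (x' + y).
    by rewrite ltNge (V_add_le mD DE)// -ltNge.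
  have lt2 : V (x' + y) <= V (x' + y').
    by rewrite ![x' + _]addrC (V_add_le mE ED)// ltW.
  apply: (@lt_le_trans _ _ (V (x' + y' + z))).
    rewrite ltNge (V_add_le mDE DUG)//; try exact: onU.
    by rewrite -ltNge (lt_le_trans lt1).
  rewrite ![x' + y' + _]addrC (@V_add_le G (D `|` E))//; [exact: ltW| |exact: onU].
  by rewrite setIC.
Qed.

(** Serves to upgrade monotonicity to an equivalence: a strict gap in [V] leaves room for raising
    one coordinate strictly. *)
Lemma fat_bump D E x h u : fat D -> on D x -> on E h -> D `&` E = set0 ->
  V (x + h) < u -> exists c, [/\ on D c, V x < V c & V (c + h) <= u].
Proof.
move=> [mD fD] Dx Eh DE xu; have [M M0 xM] := LinfM Dx.1.
(* The constant [M] on [D] dominates [x]; the extra 1 makes the comparison strict because [D] is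
   fat. *)
pose b : T -> R := restr D (cstf (M + 1)).
have Db : on D b by apply: on_restr => //; exact: Linf_cst.
have xb : V x < V b.
  apply: (@le_lt_trans _ _ (V (restr D (cstf M)))); last first.
    by apply: fD; rewrite ltrDl.
  apply: Vmono; [exact: Dx.1|by apply: Linf_restr => //; exact: Linf_cst|].
  move=> p; have [Dp|Dp] := pselect (D p).
    by rewrite restr_in// /cstf (le_trans (ler_norm _)).
  by rewrite restr_notin// Dx.2.
have xhbh : V (x + h) < V (b + h) by rewrite ltNge (V_add_le mD DE)// -ltNge.
have [|c Dc cE] := @V_between D x b h (Num.min u (V (b + h))) Dx Db Eh.1.
  by rewrite le_min ge_min lexx orbT !ltW.
exists c; split=> //; last by rewrite cE ge_min lexx.
by rewrite ltNge -(V_add_le mD DE Dc Dx Eh) -ltNge cE lt_min xu.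
Qed.

Lemma additive_representation A B C : fat A -> fat B -> fat C ->
  A `&` B = set0 -> A `&` C = set0 -> B `&` C = set0 ->
  A `|` B `|` C = setT ->
  exists I : (T -> R) -> R,
  [/\ forall f g, Linf f -> Linf g -> V f <= V g <-> I f <= I g,
      forall D f g, measurable D -> on D f -> on (~` D) g -> I (f + g) = I f + I g &
      forall (fs : nat -> T -> R) f (M : R), (forall n, Linf (fs n)) -> Linf f ->
        (forall n p, `|fs n p| <= M) ->
        (forall p, (fun n => fs n p) @ \oo --> f p) ->
        (fun n => I (fs n)) @ \oo --> I f].
Proof.
move=> fA fB fC AB AC BC ABC.
have [mA mB mC] := And3 fA.1 fB.1 fC.1.
have [BA CA CB] : [/\ B `&` A = set0, C `&` A = set0 & C `&` B = set0].
  by split; rewrite setIC.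
have [U [UU U0]] := ultraFilterLemma (at_right_proper_filter (0 : R)).
have unit D : fat D -> 0 < V (restr D (cstf 1)) /\ inJ D (V (restr D (cstf 1))).
  move=> [mD fD]; split; last first.
    by exists (restr D (cstf 1)) => //; apply: on_restr => //; exact: Linf_cst.
  by have := fD 0 1 ltr01; rewrite (_ : restr D (cstf 0) = 0) ?V0//; exact: restr0.
have [a0 Ja] := unit A fA; have [b0 Jb] := unit B fB; have [c0 Jc] := unit C fC.
set a := V _ in a0 Ja; set b := V _ in b0 Jb; set c := V _ in c0 Jc.
(* The minimum is a value attained on all three events, hence a common unit. *)
pose dl := Num.min a (Num.min b c).
have dl0 : 0 < dl by rewrite !lt_min a0 b0.
have JA : inJ A dl by apply: (inJ_convex (inJ0 A) Ja); rewrite (ltW dl0) ge_min lexx.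
have JB : inJ B dl.
  by apply: (inJ_convex (inJ0 B) Jb); rewrite (ltW dl0) !ge_min lexx orbT.
have JC : inJ C dl.
  by apply: (inJ_convex (inJ0 C) Jc); rewrite (ltW dl0) !ge_min lexx !orbT.
have UF : ProperFilter U by exact: ultra_proper.
have [gA gB gC] := And3 (near_gauge U0 dl0 mA JA) (near_gauge U0 dl0 mB JB)
  (near_gauge U0 dl0 mC JC).
pose N e := cnt A e 0 dl.
have TBC : triple U dl N B C A.
  by split=> //; apply: filterE.
have TAB : triple U dl N A B C.
  split=> //; near=> e; have HA : gauge A e by near: e.
  have HC : gauge C e by near: e.
  exact: (cnt_gauge mB BA BC AC HA HC (inJ0 B) JB).
have TAC : triple U dl N A C B.
  split=> //; near=> e; have HA : gauge A e by near: e.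
  have HB : gauge B e by near: e.
  exact: (cnt_gauge mC CA CB AB HA HB (inJ0 C) JC).
pose p := phi U N.
(* On the values of one event the other two measure alike, so the scale [p C] on [A] and [B] and the
   scale [p B] on [C] fit all three pairwise comparisons. *)
have eA v : inJ A v -> p B v = p C v.
  by move=> Jv; apply: (phi_gauge UU U0 N dl0 mA mB mC AB AC BC JB JC Jv).
have eB v : inJ B v -> p A v = p C v.
  by move=> Jv; apply: (phi_gauge UU U0 N dl0 mB mA mC BA BC AC JA JC Jv).
have eC v : inJ C v -> p A v = p B v.
  by move=> Jv; apply: (phi_gauge UU U0 N dl0 mC mA mB CA CB AB JA JB Jv).
have on_inJ D k : on D k -> inJ D (V k) by move=> Dk; exists k.
have PAB : pairwise_mono A B (p C) (p C).
  by move=> x x' y y' *; apply: (phi_pair UU U0 dl0 TAB).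
have PAC : pairwise_mono A C (p C) (p B).
  move=> x x' y y' *; rewrite -!eA; try exact: on_inJ.
  exact: (phi_pair UU U0 dl0 TAC).
have PBC : pairwise_mono B C (p C) (p B).
  move=> x x' y y' *; rewrite -!eB -?eC; try exact: on_inJ.
  exact: (phi_pair UU U0 dl0 TBC).
pose I (f : T -> R) := p C (V (restr A f)) + p C (V (restr B f)) + p B (V (restr C f)).
have split3 f : restr A f + restr B f + restr C f = f.
  apply/funext => w; rewrite !addfE.
  have noAB : A w -> B w -> False by move=> Aw Bw; rewrite -[False]/(set0 w) -AB.
  have noAC : A w -> C w -> False by move=> Aw Cw; rewrite -[False]/(set0 w) -AC.
  have noBC : B w -> C w -> False by move=> Bw Cw; rewrite -[False]/(set0 w) -BC.
  have : (A `|` B `|` C) w by rewrite ABC.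
  move=> [[Aw|Bw]|Cw].
  - by rewrite restr_in// !restr_notin ?addr0//; [exact: noAC|exact: noAB].
  - rewrite restr_notin; last by move=> /noAB; exact.
    by rewrite restr_in// restr_notin ?addr0 ?add0r//; exact: noBC.
  - rewrite restr_notin; last by move=> /noAC; exact.
    rewrite restr_notin; last by move=> /noBC; exact.
    by rewrite restr_in// !add0r.
have Imono f g : Linf f -> Linf g -> V f <= V g -> I f <= I g.
  move=> Lf Lg; rewrite -{1}(split3 f) -{1}(split3 g).
  apply: (mono3 mA mB mC AB AC BC PAB PAC PBC); exact: on_restr.
exists I; split.
- move=> f g Lf Lg; split; first exact: Imono.
  (* [g] is raised on [A] to a function whose value still does not exceed [V f]; [phi_inc] makes the
     gain in that coordinate strict. *)
  apply: contraTT; rewrite -!ltNge => gf.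
  have Df := on_restr mA Lg.
  have mBC := measurableU _ _ mB mC.
  have ABC0 : A `&` (B `|` C) = set0 by rewrite setIUr AB AC setU0.
  have [] := @fat_bump A (B `|` C) (restr A g) (restr B g + restr C g) (V f) fA Df.
  - by apply: onU; exact: on_restr.
  - exact: ABC0.
  - by rewrite addrA split3.
  move=> x [Ax gx xf].
  have Lx : Linf (x + (restr B g + restr C g)).
    by apply: LinfD; [exact: Ax.1|apply: LinfD; exact: Linf_restr].
  apply: lt_le_trans (Imono _ _ Lx Lf xf).
  have sB := @supp_restr _ _ _ B g; have sC := @supp_restr _ _ _ C g.
  rewrite /I !restrD (restr_id Ax.2) (restr_id sB) (restr_id sC).
  rewrite (restr_disjoint AB sB) (restr_disjoint AC sC).
  rewrite (restr_disjoint BA Ax.2) (restr_disjoint BC sC).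
  rewrite (restr_disjoint CA Ax.2) (restr_disjoint CB sB).
  rewrite !addr0 !add0r !ltrD2r.
  by apply: (phi_inc UU U0 dl0 TAB) => //; exact: on_inJ.
- move=> D f g mD Df Dg.
  have on1 E : measurable E -> on (E `&` D) (restr E f).
    move=> mE; split; first exact: (on_restr mE Df.1).1.
    move=> w /not_andP[Ew|Dw]; first by rewrite restr_notin.
    by have [Ew|Ew] := pselect (E w); [rewrite restr_in// Df.2|rewrite restr_notin].
  have on2 E : measurable E -> on (E `&` ~` D) (restr E g).
    move=> mE; split; first exact: (on_restr mE Dg.1).1.
    move=> w /not_andP[Ew|Dw]; first by rewrite restr_notin.
    by have [Ew|Ew] := pselect (E w); [rewrite restr_in// Dg.2|rewrite restr_notin].
  have add E E' G (HT : triple U dl N E E' G) : p G (V (restr E (f + g))) =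
      p G (V (restr E f)) + p G (V (restr E g)).
    have [[mE _] _ _] := triple_fat HT.
    rewrite restrD; apply: (phi_add UU U0 dl0 HT (D1 := E `&` D) (D2 := E `&` ~` D)).
    - exact: measurableI.
    - by apply: measurableI => //; exact: measurableC.
    - by rewrite setIACA setICr setI0.
    - exact: subIsetl.
    - exact: subIsetl.
    - exact: on1.
    - exact: on2.
  rewrite /I (add A B C)// (add B A C); last exact: tripleC.
  rewrite (add C A B); last exact: tripleC.
  by ring.
- move=> fs f M Lfs Lf fsM fsf.
  have cont E E' G (HT : triple U dl N E E' G) :
      p G (V (restr E (fs n))) @[n --> \oo] --> p G (V (restr E f)).
    have [[mE _] _ _] := triple_fat HT.
    apply: (phi_continuous UU U0 dl0 HT (M := `|M|)).
    - by move=> n; exact: on_restr.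
    - exact: on_restr.
    - move=> n w; have [Ew|Ew] := pselect (E w).
        by rewrite restr_in// (le_trans (fsM _ _))// ler_norm.
      by rewrite restr_notin// normr0.
    - move=> w; have [Ew|Ew] := pselect (E w).
        rewrite restr_in// (_ : (fun n => _) = (fun n => fs n w))//.
        by apply/funext => n; rewrite restr_in.
      rewrite restr_notin// (_ : (fun n => _) = (fun n => 0)); first exact: cvg_cst.
      by apply/funext => n; rewrite restr_notin.
  apply: cvgD; first apply: cvgD.
  - exact: (cont A B C).
  - exact: (cont B A C (tripleC TAB)).
  - exact: (cont C A B (tripleC TAC)).
Unshelve. all: by end_near. Qed.

End Chains.

(** * Densities and the utility function *)

Section AdditiveFunctional.
Context {d : measure_display} {T : measurableType d} {R : realType}.
Variable I : (T -> R) -> R.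
Hypotheses
  (Iadd : forall D f g, measurable D -> on D f -> on (~` D) g ->
    I (f + g) = I f + I g)
  (Icvg : forall (fs : nat -> T -> R) f (M : R), (forall n, Linf (fs n)) ->
    Linf f -> (forall n p, `|fs n p| <= M) ->
    (forall p, (fun n => fs n p) @ \oo --> f p) ->
    (fun n => I (fs n)) @ \oo --> I f).
Implicit Types (A B D : set T) (f : T -> R) (x y : R).

Lemma I0 : I 0 = 0.
Proof.
have := Iadd measurableT (on0 setT) (on0 _); rewrite addr0 => /eqP.
by rewrite -subr_eq subrr eq_sym => /eqP.
Qed.

Lemma restrU A B f : A `&` B = set0 ->
  restr (A `|` B) f = restr A f + restr B f.
Proof.
move=> AB; apply/funext => w; rewrite addfE.
have nAB : A w -> ~ B w by move=> Aw Bw; rewrite -[False]/(set0 w) -AB.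
have [Aw|Aw] := pselect (A w).
  by rewrite !(restr_in _ Aw) (restr_notin _ (nAB Aw)) addr0 restr_in//; left.
have [Bw|Bw] := pselect (B w).
  by rewrite !(restr_in _ Bw) (restr_notin _ Aw) add0r restr_in//; right.
by rewrite !restr_notin ?addr0// => -[].
Qed.

Lemma I_setU A B f : measurable A -> measurable B -> A `&` B = set0 ->
  Linf f -> I (restr (A `|` B) f) = I (restr A f) + I (restr B f).
Proof.
move=> mA mB AB Lf; rewrite restrU//; apply: (Iadd mA); first exact: on_restr.
by apply: onS (on_restr mB Lf); apply: setI_subsetC; rewrite setIC.
Qed.

Lemma restr_set0 f : restr set0 f = 0.
Proof. by apply/funext => w; rewrite restr_notin. Qed.

Lemma I_sigma_additive x (F : (set T)^nat) : (forall i, measurable (F i)) ->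
  trivIset setT F -> measurable (\bigcup_i F i) ->
  (\sum_(0 <= i < n) I (restr (F i) (cstf x))) @[n --> \oo]
    --> I (restr (\bigcup_i F i) (cstf x)).
Proof.
move=> mF tF mUF; pose S n := \big[setU/set0]_(i < n) F i.
have mS n : measurable (S n) by apply: bigsetU_measurable.
have sumE n : \sum_(0 <= i < n) I (restr (F i) (cstf x)) = I (restr (S n) (cstf x)).
  elim: n => [|n IH]; first by rewrite big_geq// /S big_ord0 restr_set0 I0.
  rewrite big_nat_recr//= IH {2}/S big_ord_recr/= -/(S n) I_setU//.
    by apply: (@trivIset_bigsetUI _ predT) => //; exact: sub_trivIset tF.
  exact: Linf_cst.
under eq_fun do rewrite sumE.
apply: (@Icvg _ _ `|x|).
- by move=> n; apply: Linf_restr => //; exact: Linf_cst.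
- by apply: Linf_restr => //; exact: Linf_cst.
- by move=> n p; rewrite restrE normrM; case: (_ \in _);
    rewrite ?normr1 ?mulr1// normr0 mulr0.
move=> p; have [[i _ Fip]|nF] := pselect ((\bigcup_i F i) p).
  rewrite restr_in; last by exists i.
  apply: cvg_near_cst; exists i.+1 => // n /= ni; rewrite restr_in//.
  by rewrite /S -bigcup_mkord; exists i.
rewrite restr_notin//; apply: cvg_near_cst; apply: nearW => n.
by rewrite restr_notin// /S -bigcup_mkord => -[i _ Fip]; apply: nF; exists i.
Qed.

Section charge.
Variable x : R.

Definition icharge A : \bar R := (I (restr A (cstf x)))%:E.

Let icharge0 : icharge set0 = 0%E.
Proof. by rewrite /icharge restr_set0 I0. Qed.

Let icharge_fin A : measurable A -> icharge A \is a fin_num.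
Proof. by []. Qed.

Let icharge_sigma : semi_sigma_additive icharge.
Proof.
move=> F mF tF mUF; apply: cvg_EFin; first by apply: nearW => n; rewrite sumEFin.
under eq_fun do rewrite /= sumEFin.
exact: I_sigma_additive.
Qed.

HB.instance Definition _ := isCharge.Build _ _ _ icharge
  icharge0 icharge_fin icharge_sigma.

End charge.

Section probability.
Hypotheses (I1 : I (cstf 1) = 1)
  (Ige0 : forall A, measurable A -> 0 <= I (restr A (cstf 1))).

(* truncated because nothing is known about [I] on non-measurable functions *)
Let pm A : \bar R := (Num.max 0 (I (restr A (cstf 1))))%:E.

Let pmE A : measurable A -> pm A = (I (restr A (cstf 1)))%:E.
Proof. by move=> /Ige0 h; rewrite /pm max_r. Qed.

Let pm0 : pm set0 = 0%E.
Proof. by rewrite pmE// restr_set0 I0. Qed.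

Let pm_ge0 A : (0 <= pm A)%E.
Proof. by rewrite lee_fin le_max lexx. Qed.

Let pm_sigma : semi_sigma_additive pm.
Proof.
move=> F mF tF mUF; rewrite pmE//; apply: cvg_EFin.
  by apply: nearW => n; rewrite sumEFin.
have -> : fine \o (fun n => \sum_(0 <= i < n) pm (F i))%E =
          fun n => \sum_(0 <= i < n) I (restr (F i) (cstf 1)).
  apply/funext => n /=; rewrite sumEFin/=; apply: eq_bigr => i _.
  by rewrite max_r// Ige0.
exact: I_sigma_additive.
Qed.

HB.instance Definition _ := isMeasure.Build _ _ _ pm pm0 pm_ge0 pm_sigma.

Let pmT : pm setT = 1%E.
Proof.
rewrite pmE// -[RHS]/(1%:E) -I1; congr (I _)%:E.
by apply/funext => w; rewrite restr_in.
Qed.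

HB.instance Definition _ := Measure_isProbability.Build _ _ _ pm pmT.

Lemma exists_probability : exists P : probability T R,
  forall A, measurable A -> P A = (I (restr A (cstf 1)))%:E.
Proof. by exists pm. Qed.

End probability.

Variable P : probability T R.
Hypotheses
  (Istrict : forall A x y, measurable A -> P A <> 0%E -> x < y ->
    I (restr A (cstf x)) < I (restr A (cstf y)))
  (Inull : forall A x, measurable A -> P A = 0%E -> I (restr A (cstf x)) = 0).

Definition density (g : R -> T -> R) := forall x,
  P.-integrable setT (fun w => (g x w)%:E) /\
  forall A, measurable A ->
    (\int[P]_(w in A) (g x w)%:E = (I (restr A (cstf x)))%:E)%E.

Lemma exists_density : exists2 g, density g & forall w, g 0 w = 0.
Proof.
have ex x : exists h : T -> R, P.-integrable setT (fun w => (h w)%:E) /\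
  (forall A, measurable A ->
    (\int[P]_(w in A) (h w)%:E = (I (restr A (cstf x)))%:E)%E).
  have dom : icharge x `<< P.
    move=> A nA B mB BA; rewrite /icharge Inull//.
    exact: nA.
  have RNE w : ((fine (Radon_Nikodym (icharge x) P w))%:E =
      Radon_Nikodym (icharge x) P w)%E.
    by rewrite fineK//; exact: Radon_Nikodym_fin_num.
  exists (fun w => fine (Radon_Nikodym (icharge x) P w)); split.
    apply: (eq_integrable _ (Radon_Nikodym (icharge x) P)) => //.
    exact: Radon_Nikodym_integrable.
  move=> A mA; transitivity (icharge x A); last by [].
  by rewrite (Radon_Nikodym_integral dom mA); apply: eq_integral => w _.
have [h hP] := choice ex.
(* Densities are fixed only almost everywhere; choosing the version 0 at [x = 0] makes the utility
   vanish there at every point. *)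
exists (fun x => if x == 0 then cst 0 else h x); last by move=> w; rewrite eqxx.
move=> x; case: (eqVneq x 0) => [->|_]; last exact: hP.
split; first exact: integrable0.
by move=> A mA; rewrite integral0 [cstf 0](_ : _ = 0)// restr0 I0.
Qed.

Section with_density.
Variable g : R -> T -> R.
Hypothesis gP : density g.

Lemma density_meas x : measurable_fun setT (g x).
Proof. by have [/measurable_int/measurable_EFinP] := gP x. Qed.

(** A single null set for all [x] allows the whole family to be corrected at once, as in
    [repair]. *)
Lemma density_ae (h : R -> T -> R) : (forall x, measurable_fun setT (h x)) ->
  (exists N, [/\ measurable N, P N = 0%E & forall x w, ~ N w -> h x w = g x w]) ->
  density h.
Proof.
move=> mh [N [mN N0 hN]] x; have [ig gI] := gP x.
have ae A : ae_eq P A (fun w => (h x w)%:E) (fun w => (g x w)%:E).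
  exists N; split=> // w /= nw; apply: contrapT => Nw; apply: nw => _.
  by rewrite hN.
split; last first.
  move=> A mA; rewrite -gI//; apply: ae_eq_integral => //.
    by apply/measurable_EFinP; exact: measurable_funTS.
  by apply/measurable_EFinP; apply: measurable_funTS; exact: density_meas.
apply/integrableP; split; first exact/measurable_EFinP.
have /integrableP[_] := ig; congr (_ < _)%E; apply: ae_eq_integral => //.
- by apply: measurableT_comp => //; apply/measurable_EFinP; exact: density_meas.
- by apply: measurableT_comp => //; exact/measurable_EFinP.
- have [N' [mN' N'0 sN']] := ae setT; exists N'; split=> // w nw; apply: sN'.
  by move=> /= e; apply: nw => /e /= [->].
Qed.

(** On the level set of [f] at [x] the integrand is [g x]; the induction removes one listed value at
    a time, so [A] has to vary. *)
Lemma density_simple (s : seq R) A f : measurable A -> Linf f ->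
  (forall w, A w -> f w \in s) ->
  P.-integrable A (fun w => (g (f w) w)%:E) /\
  (\int[P]_(w in A) (g (f w) w)%:E = (I (restr A f))%:E)%E.
Proof.
move=> mA Lf; elim: s A mA => [|x s IH] A mA fs.
  have -> : A = set0 by apply/seteqP; split=> // w /fs.
  rewrite integral_set0 restr_set0 I0; split=> //.
  exact: integrable_set0.
have mfx : measurable (f @^-1` [set x]) by rewrite -[X in measurable X]setTI; apply: Lf.1.
pose A1 := A `&` f @^-1` [set x]; pose A2 := A `\` f @^-1` [set x].
have mA1 : measurable A1 by exact: measurableI.
have mA2 : measurable A2 by exact: measurableD.
have AE : A = A1 `|` A2 by rewrite setUIDK.
have A12 : A1 `&` A2 = set0.
  by apply/seteqP; split=> // w [[_ fx] [_ nfx]].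
have [i2 e2] : P.-integrable A2 (fun w => (g (f w) w)%:E) /\
    (\int[P]_(w in A2) (g (f w) w)%:E = (I (restr A2 f))%:E)%E.
  apply: IH => // w [Aw nfx]; have := fs w Aw; rewrite inE => /orP[/eqP//|//].
have [ig gI] := gP x.
have eqA1 : {in A1, (fun w => (g x w)%:E) =1 (fun w => (g (f w) w)%:E)}.
  by move=> w /set_mem[_ ->].
have i1 : P.-integrable A1 (fun w => (g (f w) w)%:E).
  apply: (eq_integrable mA1 (fun w => (g x w)%:E)) => //.
  exact: (integrableS measurableT).
have mU : measurable_fun (A1 `|` A2) (fun w => (g (f w) w)%:E).
  by apply/measurable_funU => //; split; [exact: measurable_int i1|exact: measurable_int i2].
have dA : [disjoint A1 & A2] by exact/eqP.
split.
  rewrite AE; apply/integrableP; split=> //.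
  rewrite ge0_integral_setU//; last exact: measurableT_comp.
  by apply: lte_add_pinfty; [case/integrableP: i1|case/integrableP: i2].
rewrite [in LHS]AE integral_setU// e2 -(eq_integral _ _ eqA1) gI//.
rewrite -EFinD; congr (_%:E); rewrite [in RHS]AE I_setU//; congr (I _ + _).
apply/funext => w; have [Aw|Aw] := pselect (A1 w).
  by rewrite !restr_in// [RHS]Aw.2.
by rewrite !restr_notin.
Qed.

Lemma density_lt x y : x < y -> {ae P, forall w, g x w < g y w}.
Proof.
move=> xy; pose A := [set w | g y w <= g x w].
have mA : measurable A.
  rewrite -[A]setTI; apply: measurable_fun_le => //; exact: density_meas.
exists A; split=> //; last by move=> w /= /negP; rewrite -leNgt.
apply: contrapT => PA; have := Istrict mA PA xy.
rewrite ltNge -lee_fin -(gP x).2// -(gP y).2//.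
have iS z : P.-integrable A (fun w => (g z w)%:E).
  exact: (integrableS measurableT _ _ (gP z).1).
by move=> /negP; apply; apply: le_integral => // w /set_mem; rewrite lee_fin.
Qed.

End with_density.

Definition dyad x := exists n k, x = dy n k.

Definition dyad_mono (g : R -> T -> R) := forall w x y, dyad x -> dyad y ->
  x < y -> g x w < g y w.

(** The identity in [x] is a harmless substitute on [N]: it vanishes at 0, is strictly increasing
    and has small increments on fine grids. *)
Definition repair (N : set T) (g : R -> T -> R) (x : R) (w : T) : R :=
  if w \in N then x else g x w.

Lemma density_repair g N : density g -> measurable N -> P N = 0%E ->
  density (repair N g).
Proof.
move=> gP mN N0; apply: (density_ae gP).
  move=> x; apply: measurable_fun_ifT => //; first exact: measurable_mem.
  exact: density_meas.
by exists N; split=> // x w Nw; rewrite /repair memNset.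
Qed.

Lemma exists_density_mono : exists g,
  [/\ density g, forall w, g 0 w = 0 & dyad_mono g].
Proof.
have [g gP g0] := exists_density.
pose q i : R := if (unpickle i : option (nat * int)) is Some (n, k) then dy n k else 0.
have qP x : dyad x -> exists i, x = q i.
  by move=> [n [k ->]]; exists (pickle (n, k)); rewrite /q pickleK.
have : {ae P, forall w, forall i j, q i < q j -> g (q i) w < g (q j) w}.
  apply: ae_foralln => i; apply: ae_foralln => j.
  have [ij|_] := ltP (q i) (q j); last exact: aeW.
  by apply: filterS (density_lt gP ij).
move=> [N [mN N0 sN]]; exists (repair N g); split.
- exact: density_repair.
- by move=> w; rewrite /repair; case: ifP.
move=> w x y /qP[i ->] /qP[j ->] ij; rewrite /repair.
case: ifPn => // /negP Nw; apply: contrapT => h.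
by apply/Nw/mem_set/sN => /= /(_ i j ij).
Qed.

(** * Absence of jumps *)

Section nojump.
Variables (g : R -> T -> R) (M : nat) (eps : R).
Hypotheses (gP : density g) (gmono : dyad_mono g) (eps0 : 0 < eps).

(** The grid of mesh [2 ^- n] from [- M] to [M], whose [K n] cells are indexed by naturals. *)
Let pt n j : R := dy n (j%:Z - (M * 2 ^ n)%N%:Z).
Let K n := (2 * M * 2 ^ n)%N.

Let ptE n j : pt n j = j%:R / 2 ^+ n - M%:R.
Proof.
rewrite /pt /dy rmorphB/= mulrBl; congr (_ - _).
by rewrite -pmulrn natrM natrX mulfK// gt_eqF// exp2_gt0.
Qed.

Let dpt n j : dyad (pt n j). Proof. by exists n, (j%:Z - (M * 2 ^ n)%N%:Z). Qed.

Let pt_bound n j : (j <= K n)%N -> `|pt n j| <= M%:R.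
Proof.
move=> jK; rewrite ptE ler_norml lerBrDr addNr divr_ge0 ?exprn_ge0//=.
rewrite lerBlDr ler_pdivrMr ?exp2_gt0// -natrD -natrX -natrM ler_nat.
by rewrite (leq_trans jK)// /K mul2n addnn.
Qed.

Let ptS n j : pt n j.+1 = pt n j + 2 ^- n.
Proof. by rewrite !ptE -natr1 mulrDl mul1r addrAC. Qed.

Let jump n w j := eps <= g (pt n j.+1) w - g (pt n j) w.

Let mjump n j : measurable_fun setT (fun w => jump n w j).
Proof.
apply: measurable_fun_ler; first exact: measurable_cst.
by apply: measurable_funB; exact: density_meas.
Qed.

(** The points at which every level has a cell with an increment of at least [eps]. *)
Let J := \bigcap_n [set w | has (jump n w) (iota 0 (K n))].

Let mJ : measurable J.
Proof.
apply: bigcapT_measurable => n.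
have : measurable_fun setT (fun w => has (jump n w) (iota 0 (K n))).
  by elim: (iota _ _) => //= j s IH; apply: measurable_or.
by move=> /(_ measurableT [set true]); rewrite setTI; apply.
Qed.

Let c n w := find (jump n w) (iota 0 (K n)).

Let cK n w : J w -> (c n w < K n)%N.
Proof. by move=> Jw; rewrite -[X in (_ < X)%N](size_iota 0) -has_find; exact: Jw. Qed.

Let cjump n w : J w -> jump n w (c n w).
Proof.
move=> Jw; have := nth_find 0%N (Jw n Logic.I).
by rewrite nth_iota// cK.
Qed.

Let cfirst n w i : J w -> (i < c n w)%N -> ~~ jump n w i.
Proof.
move=> Jw ic; have := before_find 0%N ic; rewrite nth_iota ?add0n => [->//|].
by rewrite (ltn_trans ic)// cK.
Qed.

(** Used with [phi] the left and the right endpoint of the first jumping cell, which gives [F] and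
    [H]. *)
Let G n (phi : nat -> R) w : R := if w \in J then phi (c n w) else 0.

Let LG n phi (B : R) : (forall j, (j < K n)%N -> `|phi j| <= B) -> Linf (G n phi).
Proof.
move=> phiB; split; last first.
  exists `|B| => w; rewrite /G; case: ifPn => [/set_mem Jw|_]; last by rewrite normr0.
  by rewrite (le_trans (phiB _ (cK _ Jw)))// ler_norm.
(* [find] is unfolded into nested conditionals, whose measurability follows by induction on the
   list. *)
pose fo s (w : T) := foldr (fun j a => if jump n w j then phi j else a) 0 s.
have foE s w : has (jump n w) s -> fo s w = phi (nth 0%N s (find (jump n w) s)).
  by elim: s => //= j s IH; case: ifP.
have mfo s : measurable_fun setT (fo s).
  elim: s => [|j s IH]; first exact: measurable_cst.
  by apply: measurable_fun_ifT => //; exact: measurable_cst.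
have -> : G n phi = fun w => if w \in J then fo (iota 0 (K n)) w else 0.
  apply/funext => w; rewrite /G; case: ifPn => // /set_mem Jw.
  by rewrite foE ?nth_iota ?cK//; exact: Jw.
by apply: measurable_fun_ifT => //; exact: measurable_mem.
Qed.

Let F n := G n (pt n).
Let H n := G n (fun j => pt n j.+1).

Let LF n : Linf (F n).
Proof. by apply: (@LG _ _ M%:R) => j /ltnW; exact: pt_bound. Qed.

Let LH n : Linf (H n).
Proof. by apply: (@LG _ _ M%:R) => j; exact: pt_bound. Qed.

Let FM n w : `|F n w| <= M%:R.
Proof.
rewrite /F /G; case: ifPn => [/set_mem Jw|_]; last by rewrite normr0.
by apply/pt_bound/ltnW/cK.
Qed.

Let HM n w : `|H n w| <= M%:R.
Proof.
rewrite /H /G; case: ifPn => [/set_mem Jw|_]; last by rewrite normr0.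
by apply/pt_bound/cK.
Qed.

Let gle w x y : dyad x -> dyad y -> x <= y -> g x w <= g y w.
Proof.
by move=> dx dy; rewrite le_eqVlt => /orP[/eqP ->//|/(gmono w dx dy)/ltW].
Qed.

(* The first jump can only move to the right when the grid is refined: an
   interval before it carries an increment smaller than [eps], and so do its
   halves. *)
Let Fhomo w : {homo F^~ w : n m / (n <= m)%N >-> n <= m}.
Proof.
apply/nondecreasing_seqP => n; rewrite /F /G; case: ifPn => // /set_mem Jw.
suff h : (2 * c n w <= c n.+1 w)%N.
  rewrite !ptE lerD2r ler_pdivrMr ?exp2_gt0// exprS.
  have -> : (c n.+1 w)%:R / (2 * 2 ^+ n) * 2 ^+ n = (c n.+1 w)%:R / 2 :> R.
    by field; rewrite gt_eqF ?exp2_gt0.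
  by rewrite ler_pdivlMr// -natrM ler_nat mulnC.
rewrite leqNgt; apply/negP => lt.
set j := c n.+1 w in lt; pose i := j./2.
have ic : (i < c n w)%N by rewrite /i; lia.
have /negP := cfirst Jw ic; apply; apply: (le_trans (cjump n.+1 Jw)).
have ij : (2 * i <= j)%N /\ (j <= 2 * i + 1)%N by rewrite /i; lia.
have hl : pt n i <= pt n.+1 j.
  rewrite !ptE lerD2r ler_pdivrMr ?exp2_gt0// exprS.
  have -> : j%:R / (2 * 2 ^+ n) * 2 ^+ n = j%:R / 2 :> R.
    by field; rewrite gt_eqF ?exp2_gt0.
  by rewrite ler_pdivlMr// -natrM ler_nat mulnC; case: ij.
have hr : pt n.+1 j.+1 <= pt n i.+1.
  rewrite !ptE lerD2r ler_pdivlMr ?exp2_gt0// exprS.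
  have -> : j.+1%:R / (2 * 2 ^+ n) * 2 ^+ n = j.+1%:R / 2 :> R.
    by field; rewrite gt_eqF ?exp2_gt0.
  by rewrite ler_pdivrMr// -natrM ler_nat; lia.
by apply: lerB; exact: gle.
Qed.

Let Fcvg w : F n w @[n --> \oo] --> limn (F^~ w).
Proof.
apply: nondecreasing_is_cvgn; first exact: Fhomo.
by exists M%:R => _ [n _ <-]; rewrite (le_trans (ler_norm _)).
Qed.

Let LFl : Linf (fun w => limn (F^~ w)).
Proof.
split; first by apply: (measurable_fun_cvg (fun n => (LF n).1)) => w _; exact: Fcvg.
exists M%:R => w; rewrite ler_norml; apply/andP; split.
  apply: limr_ge; [exact: Fcvg|apply: nearW => n].
  by have := FM n w; rewrite ler_norml => /andP[].
apply: limr_le; [exact: Fcvg|apply: nearW => n].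
by have := FM n w; rewrite ler_norml => /andP[].
Qed.

Let HE n w : H n w = F n w + (w \in J)%:R * 2 ^- n.
Proof. by rewrite /H /F /G; case: ifP => _; rewrite ?mul1r ?mul0r ?addr0// ptS. Qed.

Let Hcvg w : H n w @[n --> \oo] --> limn (F^~ w).
Proof.
have -> : H^~ w = (fun n => F n w + (w \in J)%:R * 2 ^- n).
  by apply/funext => n; exact: HE.
rewrite -[limn _]addr0 -[X in _ + X](mulr0 (w \in J)%:R).
apply: cvgD; first exact: Fcvg.
by apply: cvgM; [exact: cvg_cst|exact: cvg_exp2V].
Qed.

Let GI n phi (B : R) : (forall j, (j < K n)%N -> `|phi j| <= B) ->
  P.-integrable J (fun w => (g (G n phi w) w)%:E) /\
  (\int[P]_(w in J) (g (G n phi w) w)%:E = (I (G n phi))%:E)%E.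
Proof.
move=> phiB; have -> : I (G n phi) = I (restr J (G n phi)).
  congr I; apply/esym/restr_id => w Jw.
  by rewrite /G memNset.
apply: (density_simple gP (s := [seq phi j | j <- iota 0 (K n)])) => //.
  exact: LG phiB.
move=> w Jw; rewrite /G mem_set//; apply: map_f.
by rewrite mem_iota add0n/= cK.
Qed.

Let jump_bound n : eps * fine (P J) <= I (H n) - I (F n).
Proof.
have [iF eF] : _ /\ _ := @GI n (pt n) M%:R (fun j jK => pt_bound (ltnW jK)).
have [iH eH] : _ /\ _ := @GI n (fun j => pt n j.+1) M%:R (fun j jK => pt_bound jK).
have ie := finite_measure_integrable_cst P eps mJ.
rewrite lerBrDr addrC -lee_fin EFinD EFinM fineK ?fin_num_measure//.
rewrite -eF -eH -(integral_cst P mJ) -integralD//.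
apply: le_integral => //; first exact: integrableD.
move=> w /set_mem Jw; rewrite -EFinD lee_fin /G !mem_set//.
by have := cjump n Jw; rewrite /jump lerBrDl.
Qed.

(** [F n] and [H n] have the same bounded pointwise limit, so [I (H n) - I (F n)] tends to 0, while
    [jump_bound] keeps it above [eps] times the probability of [J]. *)
Lemma ae_nojump : {ae P, forall w, exists n, forall k : int,
  - (M * 2 ^ n)%N%:Z <= k < (M * 2 ^ n)%N%:Z ->
  g (dy n (k + 1)) w - g (dy n k) w < eps}.
Proof.
exists J; split=> //.
  apply/eqP; rewrite eq_le measure_ge0 andbT -(@fineK _ (P J)) ?fin_num_measure//.
  rewrite lee_fin -(pmulr_rle0 _ eps0).
  have : I (H n) - I (F n) @[n --> \oo] --> (0 : R).
    rewrite -(subrr (I (fun w => limn (F^~ w)))); apply: cvgB.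
      by apply: (Icvg LH LFl HM) => w; exact: Hcvg.
    by apply: (Icvg LF LFl FM) => w; exact: Fcvg.
  by move=> /cvgr_to_ge; apply; apply: nearW => n; exact: jump_bound.
move=> w /= nw n _; apply: contrapT => hn; apply: nw; exists n => k /andP[k1 k2].
rewrite ltNge; apply/negP => kj; apply: hn.
apply/hasP; exists (absz (k + (M * 2 ^ n)%N%:Z)).
  by rewrite mem_iota add0n /K; lia.
rewrite /jump /pt.
have -> : (absz (k + (M * 2 ^ n)%N%:Z))%:Z - (M * 2 ^ n)%N%:Z = k by lia.
by have -> : (absz (k + (M * 2 ^ n)%N%:Z)).+1%:Z - (M * 2 ^ n)%N%:Z = k + 1 by lia.
Qed.

End nojump.

(** Natural parameters [M] and [m] keep the exceptional sets countable in number. One level [n]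
    suffices, since monotonicity controls the finer ones. *)
Definition dyad_cont (g : R -> T -> R) := forall w (M m : nat), exists n,
  forall k : int, - (M * 2 ^ n)%N%:Z <= k < (M * 2 ^ n)%N%:Z ->
  g (dy n (k + 1)) w - g (dy n k) w < m.+1%:R^-1.

Lemma dyad_cont_id (m : nat) : exists n, forall k : int,
  dy n (k + 1) - dy n k < m.+1%:R^-1 :> R.
Proof.
have /cvgrPdist_lt/(_ m.+1%:R^-1) := @cvg_exp2V R.
rewrite invr_gt0 ltr0n => /(_ isT)[n _ /(_ n (leqnn n))] /=.
rewrite sub0r normrN => h; exists n => k; apply: le_lt_trans h.
by rewrite /dy rmorphD/= mulrDl addrC addKr mul1r ler_norm.
Qed.

Lemma exists_density_regular : exists g,
  [/\ density g, forall w, g 0 w = 0, dyad_mono g & dyad_cont g].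
Proof.
have [g [gP g0 gm]] := exists_density_mono.
have : {ae P, forall w, forall M m : nat, exists n, forall k : int,
    - (M * 2 ^ n)%N%:Z <= k < (M * 2 ^ n)%N%:Z ->
    g (dy n (k + 1)) w - g (dy n k) w < m.+1%:R^-1}.
  apply: ae_foralln => M; apply: ae_foralln => m.
  by apply: ae_nojump => //; rewrite invr_gt0.
move=> [N [mN N0 sN]]; exists (repair N g); split.
- exact: density_repair.
- by move=> w; rewrite /repair; case: ifP.
- by move=> w x y dx dy xy; rewrite /repair; case: ifP => // _; exact: gm.
- move=> w M m; have [Nw|Nw] := pselect (N w).
    have [n hn] := dyad_cont_id m; exists n => k _.
    by rewrite /repair mem_set.
  have [n hn] : exists n, forall k : int,
      - (M * 2 ^ n)%N%:Z <= k < (M * 2 ^ n)%N%:Z ->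
      g (dy n (k + 1)) w - g (dy n k) w < m.+1%:R^-1.
    by apply: contrapT => h; apply: Nw; apply: sN => /= /(_ M m).
  by exists n => k /hn; rewrite /repair memNset.
Qed.

(** * Extension from the dyadic numbers *)

Section utility.
Variable g : R -> T -> R.
Hypotheses (gP : density g) (g0 : forall w, g 0 w = 0) (gm : dyad_mono g)
  (gc : dyad_cont g).

Let gle w x y : dyad x -> dyad y -> x <= y -> g x w <= g y w.
Proof.
by move=> dx dy; rewrite le_eqVlt => /orP[/eqP ->//|/(gm w dx dy)/ltW].
Qed.

Let dfl n x : dyad (fl n x). Proof. by exists n, (Num.floor (x * 2 ^+ n)). Qed.

Let dyadz (k : int) : dyad k%:~R.
Proof. by exists 0%N, k; rewrite /dy expr0 divr1. Qed.

Lemma fl_nondec x : {homo (fl (R := R))^~ x : n m / (n <= m)%N >-> n <= m}.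
Proof.
apply/nondecreasing_seqP => n; rewrite /fl /dy ler_pdivrMr ?exp2_gt0// exprS.
set a := Num.floor _; set b := Num.floor _.
have -> : b%:~R / (2 * 2 ^+ n) * 2 ^+ n = b%:~R / 2 :> R.
  by field; rewrite gt_eqF ?exp2_gt0.
have ab : a * 2 <= b.
  rewrite floor_ge_int rmorphM/= mulrC -mulrCA ler_pM2l// mulrC.
  by have := floor_le (x * 2 ^+ n); rewrite mulrC.
by rewrite ler_pdivlMr//; move: ab; rewrite -(ler_int R) rmorphM.
Qed.

Lemma fl_ge_dyad m k x : dy m k <= x -> forall n, (m <= n)%N -> dy m k <= fl n x.
Proof.
move=> kx n mn; apply: le_trans (fl_nondec x mn).
rewrite /fl /dy ler_pM2r ?invr_gt0 ?exp2_gt0// ler_int floor_ge_int.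
by rewrite -ler_pdivrMr ?exp2_gt0.
Qed.

(** The floors are nondecreasing in [n], so the limit exists by monotonicity; [util_le] and
    [util_ge] make it agree with [g] at dyadic numbers. *)
Definition util w x : R := limn (fun n => g (fl n x) w).

Let seq_nondec w x : {homo (fun n => g (fl n x) w) : n m / (n <= m)%N >-> n <= m}.
Proof. by move=> n m nm; apply: gle => //; exact: fl_nondec. Qed.

Lemma util_cvg w x : g (fl n x) w @[n --> \oo] --> util w x.
Proof.
apply: nondecreasing_is_cvgn; first exact: seq_nondec.
exists (g (Num.floor x + 1)%:~R w) => _ [n _ <-]; apply: gle => //.
apply: (le_trans (fl_le n x)).
by have /andP[_ /ltW] := floor_itv x.
Qed.

Lemma util_le w x q : dyad q -> x <= q -> util w x <= g q w.
Proof.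
move=> dq xq; apply: limr_le; first exact: util_cvg.
by apply: nearW => n; apply: gle => //; exact: le_trans (fl_le n x) xq.
Qed.

Lemma util_ge w x q : dyad q -> q <= x -> g q w <= util w x.
Proof.
move=> dq qx; apply: limr_ge; first exact: util_cvg.
have [m [k qE]] := dq; exists m => // n /= mn; apply: gle => //.
by rewrite qE; apply: fl_ge_dyad => //; rewrite -qE.
Qed.

Lemma util0 w : util w 0 = 0.
Proof.
apply/eqP; rewrite eq_le -{2 3}(g0 w).
by rewrite (util_le w (dyadz 0))// (util_ge w (dyadz 0)).
Qed.

Lemma util_inc w x y : x < y -> util w x < util w y.
Proof.
move=> xy; have xy2 : 0 < (y - x) / 2 by rewrite divr_gt0// subr_gt0.
have [n hn] : exists n, 2 ^- n < (y - x) / 2.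
  have /cvgrPdist_lt/(_ _ xy2)[n _ /(_ n (leqnn n))] := @cvg_exp2V R.
  by rewrite /= sub0r normrN => /(le_lt_trans (ler_norm _)) h; exists n.
(* With this mesh the grid points of index [k + 1] and [k + 2] both lie between [x] and [y]. *)
pose k := Num.floor (x * 2 ^+ n).
have dyS j : dy n (j + 1) = dy n j + 2 ^- n :> R.
  by rewrite /dy rmorphD/= mulrDl mul1r.
have e0 : 0 < 2 ^- n :> R by rewrite invr_gt0 exp2_gt0.
have [h1 h2] := (fl_le n x, fl_gt n x).
have dk : fl n x = dy n k by [].
apply: (@le_lt_trans _ _ (g (dy n (k + 1)) w)).
  by apply: util_le; [exists n, (k + 1)|rewrite dyS -dk ltW].
apply: (@lt_le_trans _ _ (g (dy n (k + 1 + 1)) w)).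
  by apply: gm; [exists n, (k + 1)|exists n, (k + 1 + 1)|rewrite (dyS (k + 1)) ltrDl].
by apply: util_ge; [exists n, (k + 1 + 1)|rewrite !dyS -dk; lra].
Qed.

Lemma util_continuous w : continuous (util w).
Proof.
move=> x; apply/cvgrPdist_lt => e e0.
pose m := Num.truncn (2 / e).
have me : m.+1%:R^-1 <= e / 2.
  rewrite -[leRHS]invrK invf_div lef_pV2 ?posrE ?divr_gt0//.
  by rewrite ltW// truncnS_gt.
(* The margin 2 keeps the grid points of index [k - 1], [k] and [k + 1] inside the window of
   [dyad_cont]. *)
pose M := (Num.truncn (`|x| + 2)).+1.
have hM : `|x| + 2 < M%:R by exact: truncnS_gt.
have [n hn] := gc w M m.
pose k := Num.floor (x * 2 ^+ n).
have dyS j : dy n (j + 1) = dy n j + 2 ^- n :> R.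
  by rewrite /dy rmorphD/= mulrDl mul1r.
have n0 : 0 < 2 ^- n :> R by rewrite invr_gt0 exp2_gt0.
have n1 : 2 ^- n <= 1 :> R by rewrite invf_le1 ?exp2_gt0// exprn_ege1// ler1n.
have dk : fl n x = dy n k by [].
have [h1 h2] := (fl_le n x, fl_gt n x).
have kB : dy n (k - 1) = dy n k - 2 ^- n :> R.
  by have := dyS (k - 1); rewrite subrK => ->; rewrite addrK.
have dyM (j : int) : `|dy n j : R| < M%:R -> - (M * 2 ^ n)%N%:Z <= j < (M * 2 ^ n)%N%:Z.
  rewrite /dy normrM (ger0_norm (x := _^-1)) ?(ltW n0)// ltr_pdivrMr ?exp2_gt0//.
  rewrite -natrX -natrM -intr_norm pmulrn ltr_int => jM.
  by move: jM; lia.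
move: (ler_norm x) (ler_norm (- x)); rewrite normrN => x1 x2.
have i1 : g (dy n (k + 1)) w - g (dy n k) w < m.+1%:R^-1.
  by apply/hn/dyM; rewrite -dk ltr_norml; apply/andP; split; lra.
have i2 : g (dy n k) w - g (dy n (k - 1)) w < m.+1%:R^-1.
  have := hn (k - 1); rewrite subrK; apply; apply: dyM.
  by rewrite kB -dk ltr_norml; apply/andP; split; lra.
have d1 : dyad (dy n (k - 1)) by exists n, (k - 1).
have d2 : dyad (dy n (k + 1)) by exists n, (k + 1).
(* [x] may itself be the grid point of index [k], so the neighbourhood reaches back to [k - 1]; two
   increments, each less than [e / 2], bound the oscillation. *)
have b1 : dy n (k - 1) < x by rewrite kB -dk; lra.
have b2 : x < dy n (k + 1) by rewrite dyS -dk.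
near=> y.
have y1 : dy n (k - 1) < y by near: y; exact: lt_nbhsr.
have y2 : y < dy n (k + 1) by near: y; exact: lt_nbhsl.
have := util_le w d2 (ltW y2); have := util_le w d2 (ltW b2).
have := util_ge w d1 (ltW y1); have := util_ge w d1 (ltW b1).
have := lt_le_trans i1 me; have := lt_le_trans i2 me.
rewrite ltr_norml => {me i1 i2} ? ? ? ? ? ?; apply/andP; split; lra.
Unshelve. all: by end_near. Qed.

(** Each approximation depends on [p.1] alone on the countably many pieces where [fl n p.2] is
    constant. *)
Lemma util_measurable : measurable_fun setT (fun p : T * R => util p.1 p.2).
Proof.
apply: (@measurable_fun_cvg _ _ _ _ (fun n p => g (fl n p.2) p.1)); last first.
  by move=> [w x] _; exact: util_cvg.
move=> n; pose z i : int := if unpickle i is Some k then k else 0.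
pose E i := [set p : T * R | fl n p.2 = dy n (z i)].
have mE i : measurable (E i).
  rewrite -[E i]setTI.
  have mfl : measurable_fun setT (fun p : T * R => fl n p.2).
    apply: (measurableT_comp (f := fl n)); last exact: measurable_snd.
    by apply: nondecreasing_measurable => //; exact: fl_homo.
  exact: (mfl measurableT [set dy n (z i)]).
have -> : [set: T * R] = \bigcup_i E i.
  apply/seteqP; split=> // -[w x] _; exists (pickle (Num.floor (x * 2 ^+ n))) => //.
  by rewrite /E /= /z pickleK.
apply/measurable_fun_bigcup => // i.
apply: (eq_measurable_fun (fun p : T * R => g (dy n (z i)) p.1)).
  by move=> p /set_mem; rewrite /E /= => ->.
apply: measurable_funTS; apply: measurableT_comp; first exact: density_meas.
exact: measurable_fst.
Qed.

Lemma util_regular : F_regular util.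
Proof.
split; first exact: util_continuous.
split; first by move=> w x y; exact: util_inc.
by split; [exact: util0|exact: util_measurable].
Qed.

(** For the dyadic floors of [f] this is [density_simple]; the integrals pass to the limit by
    dominated convergence and the values of [I] by [Icvg]. *)
Lemma util_integral f : Linf f ->
  P.-integrable setT (fun w => (util w (f w))%:E) /\
  (\int[P]_w (util w (f w))%:E = (I f)%:E)%E.
Proof.
move=> Lf; have [M M0 fM] := LinfM Lf.
pose K := (Num.truncn M).+1.
have MK : M < K%:R by exact: truncnS_gt.
have simple n : P.-integrable setT (fun w => (g (fl n (f w)) w)%:E) /\
    (\int[P]_w (g (fl n (f w)) w)%:E = (I (fl n \o f))%:E)%E.
  have [s hs] := fl_finite n Lf.
  have := @density_simple _ gP [seq dy n k | k <- s] setT (fl n \o f) measurableT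
    (Linf_fl n Lf).
  have -> : restr setT (fl n \o f) = fl n \o f.
    by apply/funext => w; rewrite restr_in.
  by apply=> w _; exact: map_f.
have Kd : dyad K%:R by have := dyadz K%:Z; rewrite -pmulrn.
have NKd : dyad (- K%:R) by have := dyadz (- K%:Z); rewrite rmorphN/= -pmulrn.
have i1 : P.-integrable setT (fun w => `|(g K%:R w)%:E|%E).
  by apply: integrable_abse; exact: (gP _).1.
have i2 : P.-integrable setT (fun w => `|(g (- K%:R) w)%:E|%E).
  by apply: integrable_abse; exact: (gP _).1.
have meas_lim : measurable_fun setT (fun w => (util w (f w))%:E).
  apply/measurable_EFinP.
  apply: (@measurable_fun_cvg _ _ _ _ (fun n w => g (fl n (f w)) w)).
    by move=> n; have [/measurable_int/measurable_EFinP] := simple n.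
  by move=> w _; exact: util_cvg.
(* By monotonicity the integrands lie between the densities at [- K%:R] and [K%:R], both
   integrable. *)
have [] := @dominated_convergence _ _ _ P setT measurableT
  (fun n w => (g (fl n (f w)) w)%:E) (fun w => (util w (f w))%:E)
  (fun w => (`|(g K%:R w)%:E| + `|(g (- K%:R) w)%:E|)%E).
- by move=> n; exact: measurable_int (simple n).1.
- exact: meas_lim.
- by apply: aeW => w _; apply: cvg_EFin; [exact: nearW|exact: util_cvg].
- exact: integrableD.
- apply: aeW => w n _; rewrite -EFinD lee_fin.
  have := fM w; rewrite ler_norml => /andP[f1 f2].
  have u1 : g (fl n (f w)) w <= g K%:R w.
    by apply: gle => //; rewrite (le_trans (fl_le _ _))// (le_trans f2)// ltW.
  have u2 : g (- K%:R) w <= g (fl n (f w)) w.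
    apply: gle => //.
    have KE : - K%:R = dy 0 (- K%:Z) :> R.
      by rewrite /dy expr0 divr1 rmorphN/= -pmulrn.
    rewrite KE; apply: fl_ge_dyad => //; rewrite -KE (le_trans _ f1)// lerN2.
    exact: ltW.
  move: (ler_norm (g K%:R w)) (ler_norm (- g (- K%:R) w)); rewrite normrN.
  move: (normr_ge0 (g K%:R w)) (normr_ge0 (g (- K%:R) w)).
  by move=> *; rewrite ler_norml; apply/andP; split; lra.
move=> iu _ cu; split=> //.
apply: (cvg_unique _ cu); first exact: ereal_hausdorff.
have -> : [sequence (\int[P]_x (g (fl n (f x)) x)%:E)%E]_n =
          EFin \o (fun n => I (fl n \o f)).
  by apply/funext => n; rewrite /= (simple n).2.
apply: cvg_EFin; first exact: nearW.
apply: (@Icvg _ _ (M + 1)) => //.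
- by move=> n; exact: Linf_fl.
- by move=> n w; rewrite (le_trans (fl_norm _ _))// lerD2r.
- by move=> w; exact: fl_cvg.
Qed.

End utility.

End AdditiveFunctional.

(** * Expected utility representation *)

Theorem mainTheorem4 (d : measure_display) (T : measurableType d) (R : realType)
  (pref : (T -> R) -> (T -> R) -> Prop) :
  (exists A B C : set T,
      [/\ measurable A, measurable B & measurable C] /\
      [/\ A `&` B = set0, A `&` C = set0 & B `&` C = set0] /\
      [/\ ~ null_event pref A, ~ null_event pref B & ~ null_event pref C]) ->
  preference_order pref -> SM pref -> PC pref -> ST pref ->
  exists (P : probability T R) (u : T -> R -> R),
    (forall A : set T, null_event pref A <-> (measurable A /\ P A = 0%E)) /\
    F_regular u /\
    (forall x : R, P.-integrable setT (fun w => (u w x)%:E)) /\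
    (forall f g : T -> R, Linf f -> Linf g ->
       pref f g <->
       (\int[P]_w (u w (g w))%:E <= \int[P]_w (u w (f w))%:E)%E).
Proof.
move=> [A [B [C0 [[mA mB mC0] [[AB AC0 BC0] [nA nB nC0]]]]]] po sm pc st.
(* The third event is enlarged so that the three cover the space; it stays non-null because it
   contains [C0]. *)
pose C := ~` (A `|` B).
have mC : measurable C by apply: measurableC; exact: measurableU.
have nC : ~ null_event pref C.
  apply: contra_not nC0; apply: null_event_subset => //.
  by apply: setI_subsetC; rewrite setIUr setIC AC0 setIC BC0 setU0.
have AC : A `&` C = set0 by rewrite /C setCU setIA setICr set0I.
have BC : B `&` C = set0 by rewrite /C setCU setICA setICr setI0.
have ABC : A `|` B `|` C = setT by rewrite /C setUv.
pose V := ceq pref.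
have V0 : V 0 = 0 by exact: (ceq_cst po sm pc mA nA).
have Vmono := ceq_mono po sm pc mA nA.
have Vcvg := ceq_cvg po sm pc mA nA.
have VST := ceq_ST po sm pc st mA nA.
have prefV f g : Linf f -> Linf g -> pref f g <-> V g <= V f.
  exact: (pref_ceq po sm pc mA nA).
have Vstrict D x y : measurable D -> ~ null_event pref D -> x < y ->
    V (restr D (cstf x)) < V (restr D (cstf y)).
  by move=> mD nD xy; apply: (ceq_SM po sm pc mA nA) => //; exact: Linf_cst.
have fatV D : measurable D -> ~ null_event pref D -> fat V D.
  by move=> mD nD; split=> // x y; exact: Vstrict.
have [J [JV Jadd Jcvg]] := additive_representation V0 Vmono Vcvg VST
  (fatV _ mA nA) (fatV _ mB nB) (fatV _ mC nC) AB AC BC ABC.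
have L0 : Linf (0 : T -> R) by exact: Linf_cst.
have Lc x : Linf (cstf x : T -> R) by exact: Linf_cst.
have Jlt f g : Linf f -> Linf g -> (V f < V g) = (J f < J g).
  by move=> Lf Lg; rewrite !ltNge; congr (~~ _); apply/idP/idP => /JV; apply.
have J0 : J 0 = 0 by exact: I0 Jadd.
have J1 : 0 < J (cstf 1).
  rewrite -J0 -Jlt// V0 /V (ceq_cst po sm pc mA nA).
  exact: ltr01.
(* Dividing by a positive number keeps the order and gives the measure total mass 1. *)
pose I f := J f / J (cstf 1).
have I1 : I (cstf 1) = 1 by rewrite /I divff// gt_eqF.
have Iadd D f g : measurable D -> on D f -> on (~` D) g -> I (f + g) = I f + I g.
  by move=> mD Df Dg; rewrite /I (Jadd D)// mulrDl.
have Icvg (fs : nat -> T -> R) f (M : R) : (forall n, Linf (fs n)) -> Linf f ->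
    (forall n p, `|fs n p| <= M) -> (forall p, (fun n => fs n p) @ \oo --> f p) ->
    (fun n => I (fs n)) @ \oo --> I f.
  move=> Lfs Lf fsM fsf; apply: cvgM; last exact: cvg_cst.
  exact: Jcvg Lfs Lf fsM fsf.
have IV f g : Linf f -> Linf g -> (V f <= V g) = (I f <= I g).
  move=> Lf Lg; rewrite /I ler_pM2r ?invr_gt0//.
  by apply/idP/idP => /JV; apply.
have Ilt f g : Linf f -> Linf g -> (V f < V g) = (I f < I g).
  by move=> Lf Lg; rewrite !ltNge IV.
have I00 : I 0 = 0 by rewrite /I J0 mul0r.
have Lr (D : set T) (x : R) : measurable D -> Linf (restr D (cstf x)).
  by move=> mD; exact: Linf_restr.
have Ige0 D : measurable D -> 0 <= I (restr D (cstf 1)).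
  move=> mD; rewrite -I00 -IV//; last exact: Lr.
  by apply: Vmono => //; [exact: Lr|move=> w; rewrite restrE mul1r].
have [P PE] := exists_probability Iadd Icvg I1 Ige0.
have nullI D x : null_event pref D -> I (restr D (cstf x)) = 0.
  move=> [mD nD]; have [h1 h2] := nD _ _ (Lc x) (Lc 0).
  apply/eqP; rewrite -I00 eq_le -!IV//; try exact: Lr.
  by apply/andP; split; apply/prefV => //; exact: Lr.
have nullP D : null_event pref D <-> (measurable D /\ P D = 0%E).
  split=> [nD|[mD PD]].
    by have mD := nD.1; split=> //; rewrite PE// nullI.
  apply: contrapT => nD; have := Vstrict D 0 1 mD nD ltr01.
  rewrite Ilt; try exact: Lr.
  have [<-] : (0%R)%:E = (I (restr D (cstf 1)))%:E by rewrite -PE.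
  by rewrite [cstf 0](_ : _ = 0)// restr0 I00 ltxx.
have Istrict D x y : measurable D -> P D <> 0%E -> x < y ->
    I (restr D (cstf x)) < I (restr D (cstf y)).
  move=> mD PD xy; rewrite -Ilt; try exact: Lr.
  by apply: Vstrict => // /nullP[].
have Inull D x : measurable D -> P D = 0%E -> I (restr D (cstf x)) = 0.
  by move=> mD PD; apply/nullI/nullP.
have [g [gP g0 gm gc]] := exists_density_regular Iadd Icvg Istrict Inull.
have repr f (Lf : Linf f) := util_integral Iadd Icvg gP gm Lf.
exists P, (util g); split; first exact: nullP.
split; first exact: util_regular gP g0 gm gc.
split; first by move=> x; have [] := repr _ (Lc x).
move=> f h Lf Lh; rewrite (repr _ Lf).2 (repr _ Lh).2 lee_fin -IV//.
exact: prefV.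
Qed.
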